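(* Let $h:\mathbb R^n\to\mathbb R^d$ be a geometric linear epimorphism and let $(\Delta,h,\mathcal I)$ be a quantum fan of the form $(\Delta_b,h,\mathcal I_b)$ such that $\Gamma_{(\Delta,\mathcal I)}$ is a chamber of the secondary fan. Suppose that this chamber has a wall $\Gamma_{(\Delta_0,\mathcal I)}\simeq F\times\mathbb R_{\ge0}^{\mathcal I}$, where $F$ is a facet of $\Gamma_{(\Delta,\emptyset)}$ and $(\Delta_0,h,\mathcal I)$ is a quantum fan of the same form. Then $\Gamma_{(\Delta_0,\mathcal I)}$ is a wall between two chambers $\Gamma_{(\Delta,\mathcal I)}$ and $\Gamma_{(\Delta',\mathcal I)}$, and - $\Delta_0$ is not simplicial; - $\Delta(1)=\Delta_0(1)=\Delta'(1)$; - $\Delta_0$ is the finest common coarsening of $\Delta$ and $\Delta'$; - the exceptional loci of the birational morphisms $\mathscr X_{\Delta,h,\mathcal I}\dashrightarrow\mathscr X_{\Delta_0,h,\mathcal I}$ and $\mathscr X_{\Delta',h,\mathcal I}\dashrightarrow\mathscr X_{\Delta_0,h,\mathcal I}$ are of codimension $\ge2$.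
   Context: $h$ is geometric if $h(e_i)\ne0$ for all $i$ and $h(e_j)\notin\mathbb Rh(e_i)$ for $i\ne j$. For $b\in\mathbb R^n$ put $P_b=\{x\in\mathbb R^d\mid\langle x,h(e_i)\rangle\ge-b_i\ \forall i\}$, assumed to be a polytope of dimension $d$, and $F_{i,b}=P_b\cap\{\langle x,h(e_i)\rangle=-b_i\}$. $\mathcal I_b$ is the set of $i$ with $\dim F_{i,b}<d-1$ (virtual facets), and $\Delta_b$ is the complete fan of the cones $\sigma_Q=\operatorname{Cone}(h(e_i)\mid i\notin\mathcal I_b,\ Q\subset F_{i,b})$, $Q$ running over the faces of $P_b$. $(\Delta_b,h,\mathcal I_b)$ is a quantum fan: a fan whose rays are the $\mathbb R_{\ge0}h(e_i)$, $i\notin\mathcal I_b$, with calibration $h$ and set of virtual generators $\mathcal I_b$. $\Delta(1)$ is the set of rays of $\Delta$. Secondary fan. Let $k:\mathbb R^{n-d}\to\mathbb R^n$ be a Gale transform of $h$ (injective, with image $\ker h$). $\operatorname{CSF}(\Delta)$ is the set of functions $\varphi:|\Delta|\to\mathbb R$ linear on each cone and convex in the sense $\varphi(u+v)\ge\varphi(u)+\varphi(v)$. For $J\subset\{1,\dots,n\}$, $\Gamma_{(\Delta,J)}\subset\mathbb R^{n-d}$ is the image under $k^\top$ of $$\{b\in\mathbb R^n\mid\exists\varphi\in\operatorname{CSF}(\Delta),\ \varphi(h(e_j))=-b_j\ \forall j\notin J,\ \varphi(h(e_i))\ge-b_i\ \forall i\in J\}.$$ These cones form the secondary fan in $\operatorname{Cone}(k^\top(e_1),\dots,k^\top(e_n))$;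 its maximal cones are the chambers, and the intersections of chambers are the walls (here: facets of chambers). One has $\Gamma_{(\Delta,\mathcal I)}=\Gamma_{(\Delta,\emptyset)}\times\mathbb R_{\ge0}^{\mathcal I}$, where $\mathbb R_{\ge0}^{\mathcal I}$ stands for $\operatorname{Cone}(k^\top(e_i),i\in\mathcal I)$ (direct sum decomposition). Stacks. For a quantum fan $(\Delta,h,\mathcal I)$, $\mathscr S(\Delta)=\bigcup_{\sigma\text{ maximal}}\mathbb C^{\sigma(1)}\times(\mathbb C^* )^{\sigma(1)^c}\subset\mathbb C^n$, where $\sigma(1)$ is the set of $i\notin\mathcal I$ such that $\mathbb R_{\geq 0}h(e_i)$ is a ray of $\sigma$, and $\mathscr X_{\Delta,h,\mathcal I}=[\mathscr S(\Delta)/\mathbb C^{n-d}]$, where $\mathbb C^{n-d}$ acts by $t\cdot z=E(k(t))z$, $E(z_1,\dots,z_n)=(e^{2i\pi z_1},\dots,e^{2i\pi z_n})$. A combinatorial birational map $\mathscr X_{\Delta_1,h}\dashrightarrow\mathscr X_{\Delta_2,h}$ is the identity on the common open substack given by the subfan $\Delta_1\cap\Delta_2$ of common cones; its exceptional locus is the complement of this open substack in the source. A fan $\Delta_0$ is a coarsening of $\Delta$ if $\Delta$ refines $\Delta_0$, i.e. both have the same support and every cone of $\Delta$ is contained in a cone of $\Delta_0$. *)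

(* Defs.v *)
From HB Require Import structures.
From mathcomp Require Import all_boot all_order all_algebra.
From mathcomp Require Import all_classical all_reals all_analysis.
From mathcomp Require Import complex.
From mathcomp Require mpoly.

Set Implicit Arguments.
Unset Strict Implicit.
Unset Printing Implicit Defensive.

Import Order.TTheory GRing.Theory Num.Theory.
Import numFieldNormedType.Exports.

Local Open Scope classical_set_scope.
Local Open Scope ring_scope.

(* MathComp / MathComp-Analysis.  R^m is 'cV[R]_m; the linear map
   h : R^n -> R^d is given by its matrix, so h(e_i) is the column [col i h]. *)

Section ConvexGeometry.
Context {R : realType} {m : nat}.
Implicit Types A B F C : set 'cV[R]_m.

Definition dot (x y : 'cV[R]_m) : R := (x^T *m y) 0 0.

Definition affinely_independent (r : nat) (x : 'I_r -> 'cV[R]_m) : Prop :=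
  forall c : 'I_r -> R,
    \sum_i c i = 0 -> \sum_i c i *: x i = 0 -> forall i, c i = 0.

Definition linearly_independent (r : nat) (x : 'I_r -> 'cV[R]_m) : Prop :=
  forall c : 'I_r -> R, \sum_i c i *: x i = 0 -> forall i, c i = 0.

(* Dimension of the affine hull: one less than the largest number (at most
   m + 1) of affinely independent points of A; the empty set has dimension
   -1, whence the value in int. *)
Definition affdim A : int :=
  (\max_(r < m.+2 | `[< exists x : 'I_r -> 'cV[R]_m,
      (forall i, A (x i)) /\ affinely_independent x >]) r)%:Z - 1.

(* Nonempty faces of a convex polyhedron, A itself included (u = 0).  When A
   is a cone, nonemptiness forces c = 0. *)
Definition face A F : Prop :=
  F !=set0 /\
  exists (u : 'cV[R]_m) (c : R),
    (forall x, A x -> c <= dot u x) /\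
    F = [set x : 'cV[R]_m | A x /\ dot u x = c].

Definition facet A F : Prop := face A F /\ affdim F = affdim A - 1.

Definition cone_gen (r : nat) (v : 'I_r -> 'cV[R]_m) (J : {set 'I_r}) :
    set 'cV[R]_m :=
  [set x : 'cV[R]_m | exists c : 'I_r -> R,
     (forall i, 0 <= c i) /\ x = \sum_(i in J) c i *: v i].

Definition polyhedral_cone C : Prop :=
  exists (r : nat) (v : 'I_r -> 'cV[R]_m), C = cone_gen v [set: 'I_r]%SET.

Definition strongly_convex C : Prop := forall x, C x -> C (- x) -> x = 0.

Definition simplicial_cone C : Prop :=
  exists (r : nat) (v : 'I_r -> 'cV[R]_m),
    linearly_independent v /\ C = cone_gen v [set: 'I_r]%SET.

(* C is the internal direct sum A x B. *)
Definition direct_sum C A B : Prop :=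
  C = [set z : 'cV[R]_m | exists x y, [/\ A x, B y & z = x + y]] /\
  (forall x x' y y', A x -> A x' -> B y -> B y' ->
     x + y = x' + y' -> x = x' /\ y = y').

End ConvexGeometry.

Section Fans.
Context {R : realType} {d : nat}.
Implicit Types D : set (set 'cV[R]_d).

Definition fan D : Prop :=
  [/\ finite_set D,
      (forall s, D s -> polyhedral_cone s /\ strongly_convex s),
      (forall s t, D s -> face s t -> D t) &
      (forall s t, D s -> D t -> face s (s `&` t) /\ face t (s `&` t))].

Definition support D : set 'cV[R]_d := \bigcup_(s in D) s.

Definition rays D : set (set 'cV[R]_d) := [set s | D s /\ affdim s = 1].

Definition maximal_cone D (s : set 'cV[R]_d) : Prop :=
  D s /\ forall t, D t -> s `<=` t -> t = s.

Definition simplicial_fan D : Prop := forall s, D s -> simplicial_cone s.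

(* D0 is a coarsening of D. *)
Definition coarsening D0 D : Prop :=
  support D0 = support D /\
  forall s, D s -> exists s0, D0 s0 /\ s `<=` s0.

Definition finest_common_coarsening D0 D D' : Prop :=
  [/\ fan D0, coarsening D0 D, coarsening D0 D' &
      forall D'', fan D'' -> coarsening D'' D -> coarsening D'' D' ->
        coarsening D'' D0].

(* Functions on |D| are represented by functions on R^d whose values are
   constrained on |D| only. *)
Definition CSF D : set ('cV[R]_d -> R) :=
  [set phi : 'cV[R]_d -> R |
     (forall s, D s -> exists a, forall u, s u -> phi u = dot a u) /\
     (forall u v, support D u -> support D v -> support D (u + v) ->
        phi u + phi v <= phi (u + v))].

End Fans.

Section QuantumFans.
Context {R : realType} {n d : nat} (h : 'M[R]_(d, n)).

Definition epimorphism : Prop := forall y : 'cV[R]_d, exists x, h *m x = y.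

Definition geometric_map : Prop :=
  (forall i, col i h != 0) /\
  (forall i j, i != j -> forall a : R, col j h != a *: col i h).

Definition ray_of (i : 'I_n) : set 'cV[R]_d :=
  [set x : 'cV[R]_d | exists a : R, 0 <= a /\ x = a *: col i h].

(* D has calibration h and set of virtual generators I. *)
Definition quantum_fan (D : set (set 'cV[R]_d)) (I : {set 'I_n}) : Prop :=
  fan D /\ rays D = [set ray_of i | i in [set i | i \notin I]].

Definition P_ (b : 'cV[R]_n) : set 'cV[R]_d :=
  [set x : 'cV[R]_d | forall i, - b i 0 <= dot x (col i h)].

Definition F_ (i : 'I_n) (b : 'cV[R]_n) : set 'cV[R]_d :=
  P_ b `&` [set x : 'cV[R]_d | dot x (col i h) = - b i 0].

Definition full_polytope (b : 'cV[R]_n) : Prop :=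
  bounded_set (P_ b) /\ affdim (P_ b) = d%:Z.

Definition virtual (b : 'cV[R]_n) : {set 'I_n} :=
  [set i | affdim (F_ i b) < d%:Z - 1]%SET.

Definition sigma_ (b : 'cV[R]_n) (Q : set 'cV[R]_d) : set 'cV[R]_d :=
  cone_gen (fun i => col i h)
    [set i | (i \notin virtual b) && `[< Q `<=` F_ i b >]]%SET.

Definition Delta_ (b : 'cV[R]_n) : set (set 'cV[R]_d) :=
  [set sigma_ b Q | Q in face (P_ b)].

(* (D, h, I) is a quantum fan of the form (Delta_b, h, I_b). *)
Definition polytopal_quantum_fan (D : set (set 'cV[R]_d)) (I : {set 'I_n}) :
    Prop :=
  quantum_fan D I /\
  exists b, [/\ full_polytope b, D = Delta_ b & I = virtual b].

End QuantumFans.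

Section SecondaryFan.
Context {R : realType} {n d : nat} (h : 'M[R]_(d, n)) (k : 'M[R]_(n, n - d)).

Definition gale_transform : Prop :=
  injective (fun t : 'cV[R]_(n - d) => k *m t) /\
  (forall a : 'cV[R]_n, h *m a = 0 <-> exists t : 'cV[R]_(n - d), a = k *m t).

Definition Gamma (D : set (set 'cV[R]_d)) (J : {set 'I_n}) :
    set 'cV[R]_(n - d) :=
  [set k^T *m b | b in [set b : 'cV[R]_n | exists phi, [/\ CSF D phi,
     forall j, j \notin J -> phi (col j h) = - b j 0 &
     forall i, i \in J -> - b i 0 <= phi (col i h)]]].

(* Cone(k^T(e_i), i in J) *)
Definition gale_cone (J : {set 'I_n}) : set 'cV[R]_(n - d) :=
  cone_gen (fun i => col i k^T) J.

(* J may be any set of indices i such that h(e_i) spans no ray of Delta_b: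
   taking J smaller than I_b forces the hyperplanes of index in I_b \ J to
   touch the polytope.  These are the cones meeting the interior of
   Cone(k^T(e_1), ..., k^T(e_n)); the cones contained in its boundary
   (for which P_b degenerates) are obtained as their faces. *)
Definition secondary_fan : set (set 'cV[R]_(n - d)) :=
  [set C | exists b (J : {set 'I_n}),
     [/\ full_polytope h b, J \subset virtual h b &
         face (Gamma (Delta_ h b) J) C]].

Definition chamber (C : set 'cV[R]_(n - d)) : Prop :=
  maximal_cone secondary_fan C.

Definition wall_of (C W : set 'cV[R]_(n - d)) : Prop :=
  chamber C /\ facet C W.

Definition wall_between (W C C' : set 'cV[R]_(n - d)) : Prop :=
  [/\ wall_of C W, wall_of C' W, C <> C' & W = C `&` C'].

End SecondaryFan.

(* Zariski topology of a subset X of affine space, and the codimension of a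
   closed subset defined by chains of irreducible closed subsets. *)
Section Codimension.
Context {K : fieldType} {n : nat} (X : set 'cV[K]_n).

Definition zariski_closed (Z : set 'cV[K]_n) : Prop :=
  exists S : set (mpoly.mpoly n K),
    Z = X `&` [set z : 'cV[K]_n |
                forall p, S p -> mpoly.meval (fun i => z i 0) p = 0].

Definition irreducible_closed (Z : set 'cV[K]_n) : Prop :=
  [/\ zariski_closed Z, Z !=set0 &
      forall Z1 Z2, zariski_closed Z1 -> zariski_closed Z2 ->
        Z `<=` Z1 `|` Z2 -> Z `<=` Z1 \/ Z `<=` Z2].

(* codim(Z, X) >= c: every irreducible closed Y inside Z starts a chain
   Y = Y_0 < Y_1 < ... < Y_c of irreducible closed subsets of X.  The empty
   set has infinite codimension. *)
Definition codim_ge (c : nat) (Z : set 'cV[K]_n) : Prop :=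
  forall Y, irreducible_closed Y -> Y `<=` Z ->
    exists Y_ : nat -> set 'cV[K]_n,
      [/\ Y_ 0%N = Y,
          forall i, (i <= c)%N -> irreducible_closed (Y_ i) &
          forall i, (i < c)%N -> Y_ i `<` Y_ i.+1].

End Codimension.

Section QuantumToricStacks.
Context {R : realType}.

(* The quotient stack [atlas / C^m], given by its action groupoid. *)
Record quotient_stack (m n : nat) := QuotientStack {
  atlas : set 'cV[R[i]]_n ;
  action : 'cV[R[i]]_m -> 'cV[R[i]]_n -> 'cV[R[i]]_n }.

(* Closed substacks are given by closed subsets of the atlas stable under the
   action, and their codimension is computed in the atlas. *)
Definition closed_substack (m n : nat) (X Z : quotient_stack m n) : Prop :=
  [/\ zariski_closed (atlas X) (atlas Z), action Z = action X &
      forall t z, atlas Z z -> atlas Z (action Z t z)].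

Definition substack_codim_ge (m n : nat) (c : nat)
    (X Z : quotient_stack m n) : Prop :=
  closed_substack X Z /\ codim_ge (atlas X) c (atlas Z).

Definition complement_substack (m n : nat) (X U : quotient_stack m n) :
    quotient_stack m n :=
  QuotientStack (atlas X `\` atlas U) (action X).

Definition cexp (z : R[i]) : R[i] :=
  let: (x +i* y)%C := z in
  ((expR x * cos y) +i* (expR x * sin y))%C.

Definition E (n : nat) (z : 'cV[R[i]]_n) : 'cV[R[i]]_n :=
  \col_i cexp ((0 +i* (2 * pi))%C * z i 0).

Context {n d : nat} (h : 'M[R]_(d, n)) (k : 'M[R]_(n, n - d)) (I : {set 'I_n}).

(* The index set sigma(1). *)
Definition cone_indices (s : set 'cV[R]_d) : set 'I_n :=
  [set i | i \notin I /\ (face s (ray_of h i) /\ affdim (ray_of h i) = 1)].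

Definition S_ (D : set (set 'cV[R]_d)) : set 'cV[R[i]]_n :=
  [set z : 'cV[R[i]]_n | exists s, maximal_cone D s /\
     forall i, ~ cone_indices s i -> z i 0 != 0].

Definition quantum_toric_stack (D : set (set 'cV[R]_d)) :
    quotient_stack (n - d) n :=
  QuotientStack (S_ D)
    (fun t z => \col_i (E (map_mx (real_complex R) k *m t) i 0 * z i 0)).

(* Exceptional locus of the combinatorial birational map from the stack of D1
   to the stack of D2, which is the identity on the open substack of the
   subfan of common cones. *)
Definition exceptional_locus (D1 D2 : set (set 'cV[R]_d)) :
    quotient_stack (n - d) n :=
  complement_substack (quantum_toric_stack D1)
                      (quantum_toric_stack (D1 `&` D2)).

End QuantumToricStacks.

(* Main.v *)
Require Import Defs.
From mathcomp Require Import all_boot all_order all_algebra.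
From mathcomp Require Import all_classical all_reals all_analysis.
From mathcomp Require Import zify ring lra complex.
From mathcomp Require mpoly.

Set Implicit Arguments.
Unset Strict Implicit.
Unset Printing Implicit Defensive.

Import Order.TTheory GRing.Theory Num.Theory.
Import numFieldNormedType.Exports.
(* The notations of mpoly clash with those of analysis. *)
Import (canonicals) mpoly.

Local Open Scope classical_set_scope.
Local Open Scope ring_scope.

(* Everything is done in R^n, with the vectors b, before applying k^T.  After
   relaxing the redundant inequalities of P_b, a vector b' lies over
   Gamma_(Delta_b, I_b) iff for every vertex x of P_b some point of P_b' makes
   tight all the inequalities that are tight at x.  Closedness of this condition
   under small perturbations shows that Gamma_(Delta_b, I_b) is a chamber iff P_b
   is a simple polytope.

   If u is the normal of the wall, z = k u is a relation between the vectors
   h(e_i).  Let b_0 define Delta_0.  The wall has codimension one, so every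
   relation supported on the inequalities tight at a vertex of P_(b_0) is a
   multiple of z: a vertex is either simple or degenerate, with a tight set A
   containing the support of z.  The cone on A is then not simplicial, and
   b' = b_0 - e z, for small e > 0, replaces it by the cones on A \ j with
   z_j < 0, while Delta subdivides it by cones on A \ i with z_i > 0.  The other
   cones are unchanged, so Delta' = Delta_b' lies across the wall.  The interiors
   of the cones on A \ i and on A \ j meet, so a fan coarsening both Delta and
   Delta' has a cone containing the cone on A.

   As the fans have the same rays, a point of an exceptional locus has at least
   two vanishing coordinates; freeing them one by one gives codimension two. *)

(** Testing b instead of its image loses nothing: ker k^T is the image of h^T, and adding h^T y to b
    merely translates P_b. What matters is then which inequalities can be tight together, so faces
    and cones are handled through active sets, of which there are finitely many. The only topology
    left is that of germs e -> 0+ along lines b + e w, and one e serves all active sets at once.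

    The signs around the wall come from one identity: as z is a relation, <z, b> is the sum of the
    z_i times the slacks of the inequalities at an arbitrary point x. At a point where all indices
    but j of the active set A of a degenerate vertex are tight, only z_j times the slack at j
    remains. So on the side <z, b> > 0 an omitted index has z_i > 0, on the other side z_j < 0, and
    on the wall the last slack vanishes and all of A is tight again. The direction - z is chosen for
    b' because <z, b_0 - e z> = - e <z, z> has an evident sign. *)

Section DotProduct.
Context {R : realType} {m : nat}.
Implicit Types x y z : 'cV[R]_m.

Lemma dotE x y : dot x y = \sum_i x i 0 * y i 0.
Proof. by rewrite /dot mxE; apply: eq_bigr => i _; rewrite mxE. Qed.

Lemma dotC x y : dot x y = dot y x.
Proof. by rewrite !dotE; apply: eq_bigr => i _; rewrite mulrC. Qed.

Lemma dotDr x y z : dot x (y + z) = dot x y + dot x z.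
Proof. by rewrite /dot mulmxDr mxE. Qed.

Lemma dotZr a x y : dot x (a *: y) = a * dot x y.
Proof. by rewrite /dot -scalemxAr mxE. Qed.

Lemma dotDl x y z : dot (x + y) z = dot x z + dot y z.
Proof. by rewrite !(dotC _ z) dotDr. Qed.

Lemma dotZl a x y : dot (a *: x) y = a * dot x y.
Proof. by rewrite !(dotC _ y) dotZr. Qed.

Lemma dotNr x y : dot x (- y) = - dot x y.
Proof. by rewrite -scaleN1r dotZr mulN1r. Qed.

Lemma dotNl x y : dot (- x) y = - dot x y.
Proof. by rewrite -scaleN1r dotZl mulN1r. Qed.

Lemma dotBr x y z : dot x (y - z) = dot x y - dot x z.
Proof. by rewrite dotDr dotNr. Qed.

Lemma dotBl x y z : dot (x - y) z = dot x z - dot y z.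
Proof. by rewrite dotDl dotNl. Qed.

Lemma dot0r x : dot x 0 = 0.
Proof. by rewrite /dot mulmx0 mxE. Qed.

Lemma dot0l x : dot 0 x = 0.
Proof. by rewrite dotC dot0r. Qed.

Lemma dot_sumr x I (r : seq I) (P : pred I) (F : I -> 'cV[R]_m) :
  dot x (\sum_(i <- r | P i) F i) = \sum_(i <- r | P i) dot x (F i).
Proof. by apply: (big_morph _ (dotDr x)); rewrite dot0r. Qed.

Lemma dot_suml x I (r : seq I) (P : pred I) (F : I -> 'cV[R]_m) :
  dot (\sum_(i <- r | P i) F i) x = \sum_(i <- r | P i) dot (F i) x.
Proof. by rewrite dotC dot_sumr; apply: eq_bigr => i _; rewrite dotC. Qed.

Lemma dot_ge0 x : 0 <= dot x x.
Proof. by rewrite dotE; apply: sumr_ge0 => i _; rewrite -expr2 sqr_ge0. Qed.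

Lemma dot_eq0 x : (dot x x == 0) = (x == 0).
Proof.
apply/eqP/eqP => [|->]; last by rewrite dot0r.
rewrite dotE => /eqP; rewrite psumr_eq0; last by move=> i _; rewrite -expr2 sqr_ge0.
move=> /allP x0; apply/matrixP => i j; rewrite (ord1 j) mxE.
by have := x0 i (mem_index_enum i); rewrite mulf_eq0 orbb => /eqP.
Qed.

Lemma dot_gt0 x : x != 0 -> 0 < dot x x.
Proof. by move=> x0; rewrite lt_neqAle eq_sym dot_eq0 x0 dot_ge0. Qed.

Lemma dot_delta x i : dot x (delta_mx i 0) = x i 0.
Proof.
rewrite dotE (bigD1 i) //= mxE !eqxx mulr1 big1 ?addr0 // => j ji.
by rewrite mxE (negPf ji) mulr0.
Qed.

End DotProduct.

(** * Matrices and the Fredholm alternative *)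

Lemma dot_mulmx {R : realType} (p q : nat) (M : 'M[R]_(p, q)) x y :
  dot (M^T *m x) y = dot x (M *m y).
Proof. by rewrite /dot trmx_mul trmxK mulmxA. Qed.

Lemma dot_mulmxl {R : realType} (p q : nat) (M : 'M[R]_(p, q)) x y :
  dot (M *m x) y = dot x (M^T *m y).
Proof. by rewrite -dot_mulmx trmxK. Qed.

Lemma dot_col {R : realType} (p q : nat) (M : 'M[R]_(p, q)) y i :
  dot y (col i M) = (M^T *m y) i 0.
Proof. by rewrite -dot_delta dot_mulmx colE. Qed.

Lemma mulmx_col {R : realType} (p q : nat) (M : 'M[R]_(p, q)) (g : 'cV[R]_q) :
  M *m g = \sum_i g i 0 *: col i M.
Proof.
apply/matrixP => i j; rewrite (ord1 j) mxE summxE.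
by apply: eq_bigr => l _; rewrite !mxE mulrC.
Qed.

(** Membership of w^T in the row space of M^T is tested by [cokermx M^T], whose columns lie in the
    kernel of M^T, where the hypothesis applies. *)
Lemma fredholm {R : realType} (p q : nat) (M : 'M[R]_(p, q)) (w : 'cV[R]_p) :
  (forall y, M^T *m y = 0 -> dot y w = 0) -> exists x, w = M *m x.
Proof.
move=> Mw; have : (w^T <= M^T)%MS.
  rewrite submxE; apply/eqP/matrixP => i j; rewrite (ord1 i) [RHS]mxE.
  have <- : dot (col j (cokermx M^T)) w = (w^T *m cokermx M^T) 0 j.
    by rewrite dotC /dot colE mulmxA -colE mxE.
  by apply: Mw; rewrite colE mulmxA mulmx_coker mul0mx.
case/submxP => D wD; exists D^T.
by rewrite -[w]trmxK wD trmx_mul trmxK.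
Qed.

(** * Finitely generated cones and the Farkas lemma *)

Section Cones.
Context {R : realType} {m : nat}.

Lemma cone_genP (r : nat) (v : 'I_r -> 'cV[R]_m) (J : {set 'I_r}) x :
  cone_gen v J x <-> exists c : 'I_r -> R,
    [/\ forall i, 0 <= c i, forall i, i \notin J -> c i = 0 &
        x = \sum_i c i *: v i].
Proof.
split=> [[c [c0 ->]]|[c [c0 cJ ->]]].
  exists (fun i => if i \in J then c i else 0); split=> [i|i /negPf->//|].
    by case: ifP.
  rewrite big_mkcond; apply: eq_bigr => i _; case: ifP => //.
  by rewrite scale0r.
exists c; split=> //; rewrite [RHS]big_mkcond; apply: eq_bigr => i _.
by case: ifPn => // /cJ ->; rewrite scale0r.
Qed.

Lemma cone_genS (r : nat) (v : 'I_r -> 'cV[R]_m) (J K : {set 'I_r}) :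
  J \subset K -> cone_gen v J `<=` cone_gen v K.
Proof.
move=> JK x /cone_genP[c [c0 cJ ->]]; apply/cone_genP; exists c; split=> // i iK.
by apply: cJ; apply: contra iK; apply/fintype.subsetP.
Qed.

Lemma cone_gen_mem (r : nat) (v : 'I_r -> 'cV[R]_m) (J : {set 'I_r}) i :
  i \in J -> cone_gen v J (v i).
Proof.
move=> iJ; apply/cone_genP; exists (fun j => (j == i)%:R); split=> [j|j|].
- by rewrite ler0n.
- by case: eqP => // -> /negP.
- rewrite (bigD1 i) //= eqxx scale1r big1 ?addr0 // => j /negPf ->.
  by rewrite scale0r.
Qed.

Lemma cone_gen0 (r : nat) (v : 'I_r -> 'cV[R]_m) (J : {set 'I_r}) :
  cone_gen v J 0.
Proof.
apply/cone_genP; exists (fun=> 0); split=> //.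
by rewrite big1 // => i _; rewrite scale0r.
Qed.

Lemma cone_genZ (r : nat) (v : 'I_r -> 'cV[R]_m) (J : {set 'I_r}) a x :
  0 <= a -> cone_gen v J x -> cone_gen v J (a *: x).
Proof.
move=> a0 [c [c0 ->]]; exists (fun i => a * c i); split.
  by move=> i; rewrite mulr_ge0.
by rewrite scaler_sumr; apply: eq_bigr => i _; rewrite scalerA.
Qed.

(* Induction on [#|J|]: if a functional y separates w from the cone of J but is
   negative on the extra generator v_a, project everything along v_a onto the
   hyperplane orthogonal to y. *)
Lemma farkas (r : nat) (v : 'I_r -> 'cV[R]_m) (J : {set 'I_r}) w :
  cone_gen v J w \/
  exists y, (forall i, i \in J -> 0 <= dot y (v i)) /\ dot y w < 0.
Proof.
elim: {J}#|J| {-2}J (erefl #|J|) v w => [|N IH] J cJ v w.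
  have J0 : J = finset.set0 by apply/eqP; rewrite -cards_eq0 cJ.
  have [->|w0] := eqVneq w 0; first by left; apply: cone_gen0.
  right; exists (- w); split=> [i|]; first by rewrite J0 inE.
  by rewrite dotNl oppr_lt0 dot_gt0.
have [a aJ] : exists a, a \in J by apply/finset.set0Pn; rewrite -cards_eq0 cJ.
have cJa : #|(J :\ a)%SET| = N by move: cJ; rewrite (cardsD1 a) aJ => -[].
have [Jw|[y [yJ yw]]] := IH _ cJa v w.
  by left; apply: cone_genS Jw; apply: subD1set.
have [ya|ya] := leP 0 (dot y (v a)).
  right; exists y; split=> // i iJ; have [->//|ia] := eqVneq i a.
  by apply: yJ; rewrite !inE ia.
pose p x := x - (dot y x / dot y (v a)) *: v a.
have yaV : (dot y (v a))^-1 <= 0 by rewrite invr_le0 ltW.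
have ya0 : dot y (v a) != 0 by rewrite lt_eqF.
have [|[y' [y'J y'w]]] := IH _ cJa (p \o v) (p w).
  move=> /cone_genP[c [c0 cJ0 pw]]; left; apply/cone_genP.
  (* Undoing the projection leaves the coefficient t on v_a. It is nonnegative because y is negative
     on w and on v_a but nonnegative on the other generators. *)
  pose t := dot y w / dot y (v a) - \sum_i c i * (dot y (v i) / dot y (v a)).
  have t0 : 0 <= t.
    apply: addr_ge0; first by rewrite mulr_le0 // ltW.
    rewrite oppr_ge0; apply: sumr_le0 => i _.
    have [iJ|/cJ0->] := boolP (i \in (J :\ a)%SET); last by rewrite mul0r.
    by rewrite mulr_ge0_le0 // mulr_ge0_le0 // yJ.
  exists (fun i => c i + (i == a)%:R * t); split=> [i|i iJ|].
  - by rewrite addr_ge0 // mulr_ge0.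
  - have ia : i != a by apply: contra iJ => /eqP ->.
    by rewrite (negPf ia) mul0r addr0 cJ0 // !inE (negPf iJ) andbF.
  - under eq_bigr do rewrite scalerDl.
    rewrite big_split /= [X in _ + X](bigD1 a) //= eqxx mul1r.
    rewrite [X in _ + (_ + X)]big1 ?addr0; last first.
      by move=> i /negPf ->; rewrite mul0r scale0r.
    have -> : \sum_i c i *: v i =
        p w + (\sum_i c i * (dot y (v i) / dot y (v a))) *: v a.
      rewrite pw scaler_suml -big_split; apply: eq_bigr => i _.
      by rewrite /= /p scalerBr scalerA subrK.
    by rewrite /t scalerBl addrACA subrr addr0 subrK.
(* This functional is y' composed with p: it vanishes on v_a and has on each v_i the value of y' on
   the projected vector. *)
right; exists (y' - (dot y' (v a) / dot y (v a)) *: y); split=> [i iJ|].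
  rewrite dotBl dotZl; have [->|ia] := eqVneq i a; first by rewrite divfK // subrr.
  have := y'J i; rewrite !inE ia => /(_ iJ) /=; rewrite /p dotBr dotZr.
  by rewrite mulrAC [X in _ -> _ <= _ - X]mulrAC [X in _ -> _ <= _ - X / _]mulrC.
move: y'w; rewrite /p dotBr dotZr dotBl dotZl.
by rewrite mulrAC [X in _ -> _ - X < _]mulrAC [X in _ -> _ - X / _ < _]mulrC.
Qed.

End Cones.

(** * Germs of a small positive parameter *)

Section SmallParameters.
Context {R : realType}.

Lemma near_affine_gt0 (a c : R) : 0 < a -> \forall e \near 0^'+, 0 < a + e * c.
Proof.
move=> a0; have c1 : 0 < `|c| + 1 by rewrite ltr_wpDl.
near=> e; have e0 : 0 < e by [].
have : e < a / (`|c| + 1).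
  by near: e; apply: nbhs_right_lt; apply: divr_gt0.
rewrite ltr_pdivlMr // => ea; have : - `|c| <= c by rewrite lerNl -normrN ler_norm.
by nra.
Unshelve. all: by end_near. Qed.

Lemma near_forall_fin (T : finType) (P : T -> R -> Prop) :
  (forall i, \forall e \near 0^'+, P i e) ->
  \forall e \near 0^'+, forall i, P i e.
Proof. by move=> iP; apply: filter_forall. Qed.

Lemma near_witness (P : R -> Prop) :
  (\forall e \near 0^'+, P e) -> exists2 e, 0 < e & P e.
Proof.
move=> nP; have : \forall e \near 0^'+, 0 < e /\ P e.
  by near=> e; split; near: e => //; apply: nbhs_right_gt.
by move=> /filter_ex[e [e0 eP]]; exists e.
Unshelve. all: by end_near. Qed.

End SmallParameters.

(** * Active sets, vertices and linear programming duality *)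

Section Polytopes.
Context {R : realType} {n d : nat} (h : 'M[R]_(d, n)).
Implicit Types (b w g z : 'cV[R]_n) (x y u : 'cV[R]_d) (A B : {set 'I_n}).

Definition active b x : {set 'I_n} :=
  [set i | dot x (col i h) == - b i 0]%SET.

Definition spanning A : Prop :=
  forall y, (forall i, i \in A -> dot y (col i h) = 0) -> y = 0.

(** Stated through relations in ker h supported on A, the form in which multiples of z are
    recognized later. *)
Definition independent A : Prop :=
  forall g, h *m g = 0 -> (forall i, i \notin A -> g i 0 = 0) -> g = 0.

(** Vertices as basic feasible solutions: the active set determines the point. *)
Definition vertex b x : Prop := P_ h b x /\ spanning (active b x).

Definition touches A b : Prop := exists x, P_ h b x /\ A \subset active b x.

(** The polyhedra P_b have no recession direction, whatever b is. *)
Definition positively_spanning : Prop :=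
  forall y, (forall i, 0 <= dot y (col i h)) -> y = 0.

Lemma activeP b x i : reflect (dot x (col i h) = - b i 0) (i \in active b x).
Proof. by rewrite inE; apply: eqP. Qed.

Lemma active_lt b x i : P_ h b x -> i \notin active b x ->
  - b i 0 < dot x (col i h).
Proof. by move=> Px; rewrite inE lt_neqAle eq_sym => ->; apply: Px. Qed.

Lemma dot_relation g x : h *m g = 0 -> \sum_i g i 0 * dot x (col i h) = 0.
Proof.
move=> hg; rewrite -[RHS](dot0r x) -hg mulmx_col dot_sumr.
by apply: eq_bigr => i _; rewrite dotZr.
Qed.

Lemma relation_slack g b x : h *m g = 0 ->
  dot g b = \sum_i g i 0 * (b i 0 + dot x (col i h)).
Proof.
move=> hg; under eq_bigr do rewrite mulrDr.
by rewrite big_split /= dot_relation // addr0 dotE.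
Qed.

Lemma spanningS A B : A \subset B -> spanning A -> spanning B.
Proof.
by move=> /fintype.subsetP AB sA y yB; apply: sA => i /AB; apply: yB.
Qed.

Lemma independentS A B : A \subset B -> independent B -> independent A.
Proof.
move=> /fintype.subsetP AB iB g hg gA; apply: iB => // i iB; apply: gA.
by apply: contra iB => /AB.
Qed.

(** Projection onto the coordinates in A: [h *m mask A] stands for the submatrix of the columns in A
    without any reindexing. *)
Let mask A : 'M[R]_n := diag_mx (\row_i (i \in A)%:R).

Let maskE A (g : 'cV[R]_n) i : (mask A *m g) i 0 = (i \in A)%:R * g i 0.
Proof. by rewrite mul_diag_mx !mxE. Qed.

Lemma spanning_comb A x : spanning A ->
  exists g, (forall i, i \notin A -> g i 0 = 0) /\ x = h *m g.
Proof.
move=> sA; have [|g ->] := @fredholm _ _ _ (h *m mask A) x.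
  move=> y My; rewrite (sA y) ?dot0l // => i iA; rewrite dot_col.
  move/matrixP/(_ i 0): My.
  by rewrite trmx_mul tr_diag_mx -mulmxA maskE iA mul1r => ->; rewrite mxE.
exists (mask A *m g); split; last by rewrite mulmxA.
by move=> i /negPf iA; rewrite maskE iA mul0r.
Qed.

Lemma independent_solve A w : independent A ->
  exists y, forall i, i \in A -> dot y (col i h) = w i 0.
Proof.
move=> iA; have [|y wy] := @fredholm _ _ _ (h *m mask A)^T (mask A *m w).
  move=> g; rewrite trmxK -mulmxA => hg; have g0 : mask A *m g = 0.
    by apply: iA => // i /negPf iA'; rewrite maskE iA' mul0r.
  rewrite -[RHS](dot0l w) -g0; rewrite !dotE; apply: eq_bigr => i _.
  by rewrite !maskE mulrCA mulrA.
exists y => i jA; move/matrixP/(_ i 0): wy.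
by rewrite maskE jA mul1r trmx_mul tr_diag_mx -mulmxA maskE jA mul1r dot_col => ->.
Qed.

(** Writing h(e_i) in terms of the spanning set A gives the relation g. Its support lies in B and
    contains i, whence the dependence of B. *)
Lemma spanning_extra A B i : spanning A -> A \subset B -> i \in B ->
  i \notin A -> exists g, [/\ h *m g = 0, g i 0 = 1,
    forall j, j \notin A -> j != i -> g j 0 = 0 & ~ independent B].
Proof.
move=> sA /fintype.subsetP AB iB iA; have [g [gA ig]] := spanning_comb (col i h) sA.
pose f : 'cV[R]_n := delta_mx i 0 - g.
have hf : h *m f = 0 by rewrite mulmxBr -colE -ig subrr.
have fi : f i 0 = 1 by rewrite !mxE !eqxx gA // subr0.
have fj j : j \notin A -> j != i -> f j 0 = 0.
  by move=> jA /negPf ji; rewrite !mxE ji gA // subr0.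
exists f; split=> // /(_ f hf) f0; have /eqP := oner_neq0 R; apply.
rewrite -fi f0 ?mxE // => j jB; apply: fj; first by apply: contra jB => /AB.
by apply: contra jB => /eqP ->.
Qed.

Lemma active_independent_sub A B : spanning A -> A \subset B ->
  independent B -> A = B.
Proof.
move=> sA AB iB; apply/eqP; rewrite finset.eqEsubset AB; apply/fintype.subsetP => i iBi.
by apply/negPn/negP => iA; have [g [_ _ _]] := spanning_extra sA AB iBi iA; apply.
Qed.

Lemma vertex_uniq b x y : P_ h b x -> vertex b y ->
  active b y \subset active b x -> x = y.
Proof.
move=> Px [Py sy] /fintype.subsetP yx; apply/eqP; rewrite -subr_eq0; apply/eqP.
apply: sy => i iy; have /activeP ix := yx _ iy; move/activeP: iy => iy.
by rewrite dotBl ix iy subrr.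
Qed.

Hypothesis hpos : positively_spanning.

(* Move from x along a direction orthogonal to the active normals until a new
   inequality becomes tight. *)
Lemma push_step b x u : P_ h b x -> ~ spanning (active b x) ->
  exists x', [/\ P_ h b x', active b x \proper active b x' & dot x' u <= dot x u].
Proof.
move=> Px nsp; have [y yA [yu y0]] : exists2 y,
    (forall i, i \in active b x -> dot y (col i h) = 0) & dot y u <= 0 /\ y != 0.
  apply: contrapT => no; apply: nsp => y yA; apply/eqP/negPn/negP => y0.
  apply: no; have [yu|yu] := leP (dot y u) 0; first by exists y.
  exists (- y); first by move=> i /yA yi; rewrite dotNl yi oppr0.
  by rewrite dotNl oppr_le0 oppr_eq0 ltW.
have [i0 yi0] : exists i, dot y (col i h) < 0.
  apply: contrapT => no; move/eqP: y0; apply; apply: hpos => i; rewrite leNgt.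
  by apply/negP => yi; apply: no; exists i.
(* Ratio test of the simplex method: [t i] is the time at which the i-th inequality becomes tight,
   and the earliest one is kept. *)
pose t i := (dot x (col i h) + b i 0) / - dot y (col i h).
have [i yi ti] := @arg_minP _ _ _ i0 (fun i => dot y (col i h) < 0) t yi0.
have ti0 : 0 <= t i.
  by apply: divr_ge0; [rewrite -lerBlDr sub0r Px|rewrite oppr_ge0 ltW].
exists (x + t i *: y); split.
- move=> j; rewrite dotDl dotZl; have [yj|yj] := leP 0 (dot y (col j h)).
    by rewrite (le_trans (Px j)) // lerDl mulr_ge0.
  have := ti j yj; rewrite /t ler_pdivlMr ?oppr_gt0 // -/(t i).
  by lra.
- have iA : i \notin active b x by apply/negP => /yA iy; rewrite iy ltxx in yi.
  rewrite properE; apply/andP; split.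
    apply/fintype.subsetP => j jA; apply/activeP; rewrite dotDl dotZl (yA j jA).
    by rewrite mulr0 addr0; apply/activeP.
  apply/negP => /fintype.subsetP /(_ i); rewrite (negPf iA) => /(_ _)/notF; apply.
  apply/activeP; rewrite dotDl dotZl /t invrN mulrN mulNr.
  by rewrite divfK ?lt_eqF //; lra.
- by rewrite dotDl dotZl gerDl mulr_ge0_le0.
Qed.

(** Each [push_step] enlarges the active set, which has at most n elements, so the process stops at
    a vertex. With u = 0 it just provides a vertex above a given active set. *)
Lemma push b x u : P_ h b x -> exists x', [/\ vertex b x',
  active b x \subset active b x' & dot x' u <= dot x u].
Proof.
elim: {x}(n - #|active b x|)%N {-2}x (leqnn (n - #|active b x|)%N) => [|N IH] x cx Px.
  have [sp|nsp] := pselect (spanning (active b x)); first by exists x.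
  have [x' [_ /proper_card + _]] := push_step u Px nsp.
  rewrite leqNgt => /negP[]; rewrite ltnS (leq_trans (max_card _)) // card_ord.
  by rewrite -subn_eq0 -leqn0.
have [sp|nsp] := pselect (spanning (active b x)); first by exists x.
have [x' [Px' xx' x'u]] := push_step u Px nsp.
have /(_ _ Px')[|x'' [vx'' x'x'' x''u]] := IH x'.
  move: (proper_card xx') (max_card (active b x')) cx; rewrite card_ord; lia.
exists x''; split=> //; last exact: le_trans x'u.
exact: fintype.subset_trans (proper_sub xx') x'x''.
Qed.

(** At a vertex minimizing u, the Farkas alternative would be a direction that is feasible for small
    steps and decreases u; pushing the displaced point back to a vertex contradicts minimality. This
    is the completeness of the normal fan. *)
Lemma lp_duality b u : P_ h b !=set0 ->
  exists x, vertex b x /\ cone_gen (fun i => col i h) (active b x) u.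
Proof.
move=> [x0 Px0]; have [x1 [vx1 _ _]] := push 0 Px0.
(* The minimum is taken over the finite type of active sets; [pt] recovers the vertex, which is
   unique by [vertex_uniq]. *)
pose V A := `[< exists x, vertex b x /\ active b x = A >].
pose pt A := xget 0 [set x | vertex b x /\ active b x = A].
have ptP A : V A -> vertex b (pt A) /\ active b (pt A) = A.
  by move=> /asboolP VA; apply: (xgetPex 0 VA).
have V1 : V (active b x1) by apply/asboolP; exists x1.
have [A VA Amin] := @arg_minP _ _ _ _ V (fun A => dot (pt A) u) V1.
have [vA aA] := ptP _ VA; exists (pt A); split=> //.
have [//|[y [yA yu]]] := farkas (fun i => col i h) (active b (pt A)) u.
have [e e0 Pe] : exists2 e, 0 < e & P_ h b (pt A + e *: y).
  apply: near_witness; apply: near_forall_fin => i.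
  have [iA|iA] := boolP (i \in active b (pt A)).
    near=> e; have e0 : 0 < e by [].
    rewrite dotDl dotZl; move/activeP: (iA) => ->.
    by rewrite lerDl mulr_ge0 ?yA // ltW.
  have : 0 < dot (pt A) (col i h) + b i 0.
    by rewrite -ltrBlDr sub0r; apply: active_lt => //; case: vA.
  move=> /(near_affine_gt0 (dot y (col i h))) H.
  near=> e; have : 0 < dot (pt A) (col i h) + b i 0 + e * dot y (col i h).
    by near: e.
  by rewrite dotDl dotZl; lra.
have [x' [vx' _ x'u]] := push u Pe.
have Vx' : V (active b x') by apply/asboolP; exists x'.
have := Amin _ Vx'; have [vB aB] := ptP _ Vx'.
rewrite (_ : pt (active b x') = x'); last first.
  by case: vB => PB _; apply: (vertex_uniq PB vx'); rewrite aB.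
move=> /le_trans /(_ x'u); rewrite dotDl dotZl lerDl.
by rewrite leNgt pmulr_rlt0 // yu.
Unshelve. all: by end_near. Qed.

End Polytopes.

(** * Affine dimension through homogeneous coordinates *)

Section AffineDimension.
Context {R : realType} {m : nat}.
Implicit Types (A : set 'cV[R]_m) (a : 'cV[R]_m).

(** In homogeneous coordinates affine independence becomes freeness of the rows, and an equation <x,
    a> = alpha becomes the kernel vector (a, - alpha). *)
Definition homog (r : nat) (x : 'I_r -> 'cV[R]_m) : 'M[R]_(r, m + 1) :=
  row_mx (\matrix_(i, j) x i j 0) (const_mx 1).

Lemma homog_free (r : nat) (x : 'I_r -> 'cV[R]_m) :
  affinely_independent x -> row_free (homog x).
Proof.
move=> xfree; apply: inj_row_free => v /eqP.
rewrite mul_mx_row row_mx_eq0 => /andP[/eqP vx /eqP v1]; apply/matrixP => i j; rewrite (ord1 i) mxE.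
apply: (xfree (v 0)); last first.
  apply/matrixP => l k; rewrite (ord1 k) summxE.
  transitivity ((v *m \matrix_(i, j) x i j 0) 0 l); last by rewrite vx !mxE.
  by rewrite mxE; apply: eq_bigr => s _; rewrite !mxE.
transitivity ((v *m (const_mx 1 : 'cV_r)) 0 0); last by rewrite v1 mxE.
by rewrite mxE; apply: eq_bigr => s _; rewrite mxE mulr1.
Qed.

Lemma homog_ker (r : nat) (x : 'I_r -> 'cV[R]_m) a alpha :
  (forall k, dot (x k) a = alpha) ->
  homog x *m col_mx a (const_mx (- alpha)) = 0.
Proof.
move=> xa; rewrite mul_row_col; apply/matrixP => i j; rewrite (ord1 j) !mxE.
rewrite big_ord1 !mxE mul1r -(xa i) dotE.
by under eq_bigr do rewrite mxE; rewrite subrr.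
Qed.

Lemma affinely_independent_leq (r : nat) (x : 'I_r -> 'cV[R]_m) :
  affinely_independent x -> (r <= m.+1)%N.
Proof.
by move=> /homog_free/eqP; have := rank_leq_col (homog x) => + xr; rewrite {}xr addn1.
Qed.

Lemma affdim_ge A (r : nat) (x : 'I_r -> 'cV[R]_m) :
  (forall i, A (x i)) -> affinely_independent x -> r%:Z - 1 <= affdim A.
Proof.
move=> Ax xfree; have rm := affinely_independent_leq xfree.
rewrite lerD2r lez_nat.
apply: (@bigop.bigmax_sup _ (Ordinal (rm : (r < m.+2)%N))) => //.
by apply/asboolP; exists x.
Qed.

Lemma affdim_witness A : exists (r : nat) (x : 'I_r -> 'cV[R]_m),
  [/\ forall i, A (x i), affinely_independent x & affdim A = r%:Z - 1].
Proof.
pose P (r : 'I_m.+2) := `[< exists x : 'I_r -> 'cV[R]_m,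
      (forall i, A (x i)) /\ affinely_independent x >].
(* The empty family is always admissible, so the maximum is attained; it is also what gives the
   empty set dimension -1. *)
have P0 : P ord0 by apply/asboolP; exists (fun=> 0); split=> [[]//|c _ _ []].
have [r /asboolP[x [Ax xfree]] rmax] : {r : 'I_m.+2 | P r &
    \max_(r < m.+2 | P r) r = r}.
  have cP : (0 < #|P|)%N by apply/card_gt0P; exists ord0.
  by have [r Pr rE] := bigop.eq_bigmax_cond (@nat_of_ord _) cP; exists r.
by exists r, x; split=> //; rewrite /affdim -/P rmax.
Qed.

Lemma affdim_le A : affdim A <= m%:Z.
Proof.
have [r [x [_ /affinely_independent_leq rm ->]]] := affdim_witness A.
by lia.
Qed.

(** A maximal affinely independent family has m + 1 points, so its homogenized matrix is square and
    invertible and has no nonzero kernel vector. *)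
Lemma affdim_full_inj A a alpha : affdim A = m%:Z ->
  (forall x, A x -> dot x a = alpha) -> a = 0.
Proof.
move=> dimA Aa; have [r [x [Ax xfree]]] := affdim_witness A; rewrite dimA => rm.
have {rm} rE : r = (m + 1)%N by lia.
subst r; have := homog_ker (fun k => Aa _ (Ax k)).
have := homog_free xfree; rewrite row_free_unit => /mulKmx xK.
move=> /(congr1 (mulmx (invmx (homog x)))); rewrite xK mulmx0 => /eqP.
by rewrite col_mx_eq0 => /andP[/eqP].
Qed.

(* The homogenized points form a matrix of rank at least m, so that the pairs
   (a, alpha) annihilating them form a line. *)
Lemma affdim_hyperplane_line A a a' alpha alpha' : m%:Z - 1 <= affdim A ->
  (forall x, A x -> dot x a = alpha) -> (forall x, A x -> dot x a' = alpha') ->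
  a != 0 -> exists c, a' = c *: a.
Proof.
move=> dimA Aa Aa' a0; have [r [x [Ax xfree rE]]] := affdim_witness A.
have rm : (m <= r)%N by lia.
have K1 := homog_ker (fun k => Aa _ (Ax k)).
have K2 := homog_ker (fun k => Aa' _ (Ax k)).
set q := col_mx a _ in K1; set q' := col_mx a' _ in K2.
have ker_sub (p : 'cV[R]_(m + 1)) : homog x *m p = 0 -> (p^T <= kermx (homog x)^T)%MS.
  by move=> xp; apply/sub_kermxP; rewrite -trmx_mul xp trmx0.
have q0 : q^T != 0.
  by rewrite trmx_eq0 col_mx_eq0 negb_and a0.
have : (kermx (homog x)^T <= q^T)%MS.
  have [+ <-] := mxrank_leqif_sup (ker_sub _ K1).
  have /eqP rk := homog_free xfree.
  rewrite rank_rV q0 mxrank_ker mxrank_tr rk.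
  lia.
move=> /(submx_trans (ker_sub _ K2))/sub_rVP[c qc]; exists c.
move: qc; rewrite -linearZ => /trmx_inj; rewrite /q /q' scale_col_mx.
by case/eq_col_mx.
Qed.

(** Openness along each ray from x suffices: x and the x + e delta_j, for one common e, are m + 1
    affinely independent points. *)
Lemma affdim_open A x : (forall w, \forall e \near 0^'+, A (x + e *: w)) ->
  affdim A = m%:Z.
Proof.
move=> Ax; pose w (i : 'I_m.+1) : 'cV[R]_m :=
  if unlift ord0 i is Some j then delta_mx j 0 else 0.
have [e e0 Ae] := near_witness (near_forall_fin (fun i => Ax (w i))).
have := affdim_ge Ae; rewrite intS addrAC subrr add0r => H.
apply/eqP; rewrite eq_le affdim_le H // => c c1 cx i.
have cj j : c (lift ord0 j) = 0.
  move: cx; under eq_bigr do rewrite scalerDr scalerA.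
  rewrite big_split /= -scaler_suml c1 scale0r add0r big_ord_recl /w unlift_none.
  rewrite scaler0 add0r => /matrixP/(_ j 0); rewrite summxE mxE (bigD1 j) //=.
  rewrite liftK !mxE !eqxx mulr1 big1 ?addr0.
    by move/eqP; rewrite mulf_eq0 (gt_eqF e0) orbF => /eqP.
  by move=> l /negPf lj; rewrite liftK !mxE eq_sym lj mulr0.
have [j ->|->] := unliftP ord0 i; first exact: cj.
move: c1; rewrite big_ord_recl big1 ?addr0 // => j _; exact: cj.
Qed.

Lemma affdim_open_hyperplane A x a : a != 0 ->
  (forall w, dot w a = 0 -> \forall e \near 0^'+, A (x + e *: w)) ->
  m%:Z - 1 <= affdim A.
Proof.
move=> a0 Ax; have [l al] : exists l, a l 0 != 0.
  apply: contrapT => no; move/eqP: a0; apply; apply/matrixP => i j.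
  by rewrite (ord1 j) mxE; apply/eqP/negPn/negP => ai; apply: no; exists i.
(* The basis vectors projected along delta_l onto the hyperplane orthogonal to a. As w_l = 0, the
   point x itself is one of the m points. *)
pose w (i : 'I_m) : 'cV[R]_m := delta_mx i 0 - (a i 0 / a l 0) *: delta_mx l 0.
have wa i : dot (w i) a = 0.
  by rewrite dotBl dotZl !(dotC _ a) !dot_delta divfK // subrr.
have [e e0 Ae] := near_witness (near_forall_fin (fun i => Ax _ (wa i))).
apply: (affdim_ge Ae) => c c1 cx i.
have cj j : j != l -> c j = 0.
  move=> jl; move: cx; under eq_bigr do rewrite scalerDr scalerA.
  rewrite big_split /= -scaler_suml c1 scale0r add0r => /matrixP/(_ j 0).
  rewrite summxE mxE (bigD1 j) //= !mxE !eqxx (negPf jl) /= mulr0 subr0 mulr1.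
  rewrite big1 ?addr0; last first.
    by move=> k /negPf kj; rewrite !mxE eq_sym kj (negPf jl) /= mulr0 subr0 mulr0.
  by move/eqP; rewrite mulf_eq0 (gt_eqF e0) orbF => /eqP.
have [->|/cj//] := eqVneq i l.
by move: c1; rewrite (bigD1 l) //= big1 ?addr0.
Qed.

End AffineDimension.

(** * Full-dimensional polytopes and virtual inequalities *)

Section FullPolytopes.
Context {R : realType} {n d : nat} (h : 'M[R]_(d, n)).
Implicit Types (b w g z : 'cV[R]_n) (x y u : 'cV[R]_d) (A B : {set 'I_n}).

Lemma bounded_positively_spanning b : bounded_set (P_ h b) -> P_ h b !=set0 ->
  positively_spanning h.
Proof.
move=> [M0 [_ PM0]] [x Px] y y0; apply/eqP/negPn/negP => yn0.
have y1 : 0 < `|y| by rewrite normr_gt0.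
pose M := M0 + 1; have PM u : P_ h b u -> `|u| <= M by apply: PM0; rewrite /M; lra.
have xM : `|x| <= M by exact: PM.
(* With this t the norm of t y is M + |x| + 1, too large for both x and x + t y to have norm at most
   M. *)
pose t := (M + `|x| + 1) / `|y|.
have t0 : 0 <= t by rewrite divr_ge0 // addr_ge0 // addr_ge0 // (le_trans _ xM).
have : `|x + t *: y| <= M.
  by apply: PM => i; rewrite dotDl dotZl (le_trans (Px i)) // lerDl mulr_ge0.
have : `|t *: y| <= `|x + t *: y| + `|x|.
  by rewrite -[X in `|X| <= _](addKr x) addrC ler_normB.
rewrite normrZ (ger0_norm t0) divfK ?gt_eqF //; lra.
Qed.

Lemma positively_spanning_comb u : positively_spanning h ->
  cone_gen (fun i => col i h) [set: 'I_n]%SET u.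
Proof.
move=> hpos; have [//|[y [yh yu]]] := farkas (fun i => col i h) [set: 'I_n]%SET u.
by move: yu; rewrite (hpos y) ?dot0l ?ltxx // => i; apply: yh; rewrite inE.
Qed.

(** Each vector u is a nonnegative combination of the h(e_i), so <x, u> is bounded below on P_b;
    taking u = delta_i and - delta_i bounds every coordinate. *)
Lemma positively_spanning_bounded b : positively_spanning h ->
  bounded_set (P_ h b).
Proof.
move=> hpos; have lowb u : exists M, forall x, P_ h b x -> M <= dot x u.
  have /cone_genP[c [c0 _ ->]] := positively_spanning_comb u hpos.
  exists (\sum_i c i * - b i 0) => x Px; rewrite dot_sumr; apply: ler_sum => i _.
  by rewrite dotZr ler_wpM2l.
have [M PM] : exists M : 'I_d -> R, forall x, P_ h b x -> forall i, `|x i 0| <= M i.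
  have /choice[M MP] : forall i : 'I_d, exists M, forall x, P_ h b x -> `|x i 0| <= M.
    move=> i; have [M1 H1] := lowb (delta_mx i 0); have [M2 H2] := lowb (- delta_mx i 0).
    exists (`|M1| + `|M2|) => x Px; move: (H1 x Px) (H2 x Px).
    rewrite dotNr dot_delta => H3 H4; rewrite ler_norml.
    have := ler_norm M1; have := ler_norm M2; have := normr_ge0 M1.
    have := normr_ge0 M2; have := ler_norm (- M1); have := ler_norm (- M2).
    by rewrite !normrN; lra.
  by exists M => x Px i; apply: MP.
exists (\sum_i `|M i|); split; first exact: num_real.
move=> N /ltW MN x Px /=; apply: le_trans MN.
have [->|x0] := eqVneq x 0; first by rewrite normr0 sumr_ge0.
have /mx_norm_neq0[[i j] /= xij] : mx_norm x != 0.
  by apply: contra x0 => /eqP/mx_norm_eq0 ->.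
rewrite [leLHS]xij (ord1 j); apply: le_trans (PM x Px i) _.
rewrite (bigD1 i) //=; apply: ler_wpDr; last exact: ler_norm.
exact: sumr_ge0.
Qed.

(** Slacks are averaged, and an average of nonnegative numbers vanishes only if all of them do. This
    yields relative interior points of P_b and of its facets. *)
Lemma barycenter (r : nat) (x : 'I_r -> 'cV[R]_d) b : (0 < r)%N ->
  (forall k, P_ h b (x k)) -> exists2 c, P_ h b c &
    forall i, i \in active h b c <-> forall k, i \in active h b (x k).
Proof.
move=> r0 Px; have r0' : 0 < r%:R :> R by rewrite ltr0n.
have cE i : dot (r%:R^-1 *: \sum_k x k) (col i h) + b i 0 =
    r%:R^-1 * \sum_k (dot (x k) (col i h) + b i 0).
  rewrite dotZl dot_suml big_split /= sumr_const card_ord mulrDr.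
  by rewrite -[b i 0 *+ r]mulr_natl mulKf // gt_eqF.
have slack i k : 0 <= dot (x k) (col i h) + b i 0.
  by rewrite -lerBlDr sub0r Px.
exists (r%:R^-1 *: \sum_k x k) => i.
  rewrite -subr_ge0 opprK cE mulr_ge0 ?invr_ge0 ?ler0n //.
  by apply: sumr_ge0 => k _; apply: slack.
rewrite inE -subr_eq0 opprK cE mulf_eq0 invr_eq0 (gt_eqF r0') /= psumr_eq0 //.
split=> [/allP ix k|ix].
  by have := ix k (mem_index_enum k); rewrite addr_eq0 inE.
by apply/allP => k _; have := ix k; rewrite addr_eq0 inE.
Qed.

Lemma near_slack b w x y i : - b i 0 < dot x (col i h) ->
  \forall e \near 0^'+, - (b + e *: w) i 0 < dot (x + e *: y) (col i h).
Proof.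
move=> xb; have : 0 < dot x (col i h) + b i 0 by rewrite -ltrBlDr sub0r.
move=> /(near_affine_gt0 (dot y (col i h) + w i 0)) H; near=> e.
have : 0 < dot x (col i h) + b i 0 + e * (dot y (col i h) + w i 0) by near: e.
by rewrite dotDl dotZl !mxE; lra.
Unshelve. all: by end_near. Qed.

Lemma near_slack0 b x y i : - b i 0 < dot x (col i h) ->
  \forall e \near 0^'+, - b i 0 < dot (x + e *: y) (col i h).
Proof.
move=> /(near_slack 0 y) H; near=> e; have : - (b + e *: 0) i 0 < dot (x + e *: y) (col i h).
  by near: e.
by rewrite scaler0 addr0.
Unshelve. all: by end_near. Qed.

(** An inequality tight at the barycenter of d + 1 affinely independent points of P_b is tight at
    all of them, which would force h(e_i) = 0. *)
Lemma full_polytopeP b : geometric_map h -> full_polytope h b <->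
  positively_spanning h /\ exists x, forall i, - b i 0 < dot x (col i h).
Proof.
move=> [h0 _]; split=> [[bP dimP]|[hpos [x xb]]]; last first.
  split; first exact: positively_spanning_bounded.
  apply: (@affdim_open _ _ _ x) => w; apply: near_forall_fin => i.
  by have H := near_slack0 w (xb i); near=> e; apply/ltW; near: e.
have [r [x [Px xfree]]] := affdim_witness (P_ h b); rewrite dimP => rE.
have r0 : (0 < r)%N by lia.
split; first by apply: bounded_positively_spanning bP _; exists (x (Ordinal r0)).
have [c Pc ca] := barycenter r0 Px; exists c => i; apply: active_lt => //.
apply/negP => /ca ci; have /eqP := h0 i; apply.
have dimS : affdim [set x k | k in setT] = d%:Z.
  apply/eqP; rewrite eq_le affdim_le rE; apply: affdim_ge xfree => k.
  by exists k.
apply: (@affdim_full_inj _ _ _ _ (- b i 0) dimS) => _ [k _ <-].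
by apply/activeP.
Unshelve. all: by end_near. Qed.

(** At the barycenter of a maximal affinely independent family of F_i, a second tight normal would
    be proportional to h(e_i), against geometricity. Conversely, near x the whole hyperplane of
    index i lies in P_b. *)
Lemma virtualPn b i : geometric_map h -> (i \notin virtual h b) <->
  exists x, P_ h b x /\ active h b x = [set i]%SET.
Proof.
move=> [h0 hg]; rewrite inE -leNgt; split=> [dimF|[x [Px ax]]].
  have [r [x [Fx xfree rE]]] := affdim_witness (F_ h i b).
  (* Since h(e_i) is nonzero, d is positive, so the facet contains at least one point. *)
  have d0 : (0 < d)%N.
    by case: (d) h h0 => // h' /(_ i) /eqP[]; apply/matrixP => -[].
  have r0 : (0 < r)%N by lia.
  have [c Pc ca] := barycenter r0 (fun k => (Fx k).1).
  have ci : i \in active h b c by apply/ca => k; apply/activeP; case: (Fx k).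
  exists c; split=> //; apply/finset.setP => j; rewrite [in RHS]inE.
  apply/idP/idP => [|/eqP ->//]; apply: contraTT => ji; apply/negP => /activeP jc.
  have /ca jx : j \in active h b c by apply/activeP.
  have dimS : d%:Z - 1 <= affdim [set x k | k in setT].
    by apply: le_trans dimF _; rewrite rE; apply: affdim_ge xfree => k; exists k.
  have xi y : [set x k | k in setT] y -> dot y (col i h) = - b i 0.
    by case=> k _ <-; case: (Fx k).
  have xj y : [set x k | k in setT] y -> dot y (col j h) = - b j 0.
    by case=> k _ <-; apply/activeP.
  have [a ha] := affdim_hyperplane_line dimS xi xj (h0 i).
  by move: ji; rewrite eq_sym => /hg/(_ a)/eqP.
apply: (@affdim_open_hyperplane _ _ _ x (col i h)) => // w wi.
have ai : i \in active h b x by rewrite ax inE.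
have : \forall e \near 0^'+, forall j, - b j 0 <= dot (x + e *: w) (col j h).
  apply: near_forall_fin => j; have [->|ji] := eqVneq j i.
    by near=> e; rewrite dotDl dotZl wi mulr0 addr0; apply: Px.
  have /(near_slack0 w) H : - b j 0 < dot x (col j h).
    by apply: active_lt => //; rewrite ax inE.
  by near=> e; apply/ltW; near: e.
move=> H; near=> e; split; first by near: e.
by rewrite /= dotDl dotZl wi mulr0 addr0; apply/activeP.
Unshelve. all: by end_near. Qed.

(* [tighten b] relaxes the redundant inequalities, so that the virtual
   hyperplanes no longer touch the polytope. *)
Definition tighten b : 'cV[R]_n := \col_i (b i 0 + (i \in virtual h b)%:R).

Definition tight b : Prop :=
  forall x i, P_ h b x -> i \in virtual h b -> i \notin active h b x.

Lemma P_tighten b : geometric_map h -> full_polytope h b ->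
  P_ h (tighten b) = P_ h b.
Proof.
move=> hg /(full_polytopeP _ hg)[_ [x xb]].
pose relax (J : {set 'I_n}) : 'cV[R]_n := \col_i (b i 0 + (i \in J)%:R).
have relax_ge J i : b i 0 <= relax J i 0 by rewrite mxE lerDl ler0n.
suff PJ (J : {set 'I_n}) : J \subset virtual h b -> P_ h (relax J) `<=` P_ h b.
  rewrite eqEsubset; split; first exact: PJ.
  by move=> y Py i; apply: le_trans (Py i); rewrite lerN2 relax_ge.
elim: {J}#|J| {-2}J (erefl #|J|) => [|N IH] J cJ JV y Py.
  move=> i; have := Py i; rewrite mxE (_ : J = finset.set0) ?inE ?addr0 //.
  by apply/eqP; rewrite -cards_eq0 cJ.
have [i iJ] : exists i, i \in J by apply/finset.set0Pn; rewrite -cards_eq0 cJ.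
have cJi : #|(J :\ i)%SET| = N by move: cJ; rewrite (cardsD1 i) iJ => -[].
have {}IH := IH _ cJi (fintype.subset_trans (subD1set _ _) JV).
have relaxi j : j != i -> relax (J :\ i)%SET j 0 = relax J j 0.
  by move=> ji; rewrite !mxE !inE ji.
have relaxii : relax (J :\ i)%SET i 0 = b i 0 by rewrite mxE !inE eqxx addr0.
have [yi|yi] := leP (- b i 0) (dot y (col i h)).
  apply: IH => j; have [->|ji] := eqVneq j i; first by rewrite relaxii.
  by rewrite relaxi //; apply: Py.
have xi : 0 < dot x (col i h) + b i 0 by rewrite -ltrBlDr sub0r.
pose s := (dot x (col i h) + b i 0) / (dot x (col i h) - dot y (col i h)).
have xy : 0 < dot x (col i h) - dot y (col i h) by lra.
have s0 : 0 < s by rewrite divr_gt0.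
have s1 : s < 1 by rewrite ltr_pdivrMr //; lra.
have pE j : dot (x + s *: (y - x)) (col j h) =
    (1 - s) * dot x (col j h) + s * dot y (col j h).
  by rewrite dotDl dotZl dotBl; ring.
have pi : dot (x + s *: (y - x)) (col i h) = - b i 0.
  have : s * (dot x (col i h) - dot y (col i h)) = dot x (col i h) + b i 0.
    by rewrite divfK // gt_eqF.
  by rewrite pE; lra.
have pj j : j != i -> - relax J j 0 < dot (x + s *: (y - x)) (col j h).
  move=> ji; have := Py j; have : - relax J j 0 < dot x (col j h).
    by apply: le_lt_trans (xb j); rewrite lerN2 relax_ge.
  by rewrite pE; nra.
have /fintype.subsetP/(_ _ iJ) := JV; rewrite inE ltNge => /negP[].
apply: (@affdim_open_hyperplane _ _ _ (x + s *: (y - x)) (col i h)).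
  by case: hg => + _; apply.
move=> w wi.
have H : \forall e \near 0^'+, forall j, j != i ->
    - relax J j 0 < dot (x + s *: (y - x) + e *: w) (col j h).
  apply: near_forall_fin => j; have [->|ji] := eqVneq j i; first by near=> e.
  by have H := near_slack0 w (pj j ji); near=> e => _; near: e.
near=> e; have pe : forall j, j != i ->
    - relax J j 0 < dot (x + s *: (y - x) + e *: w) (col j h) by near: e.
have pei : dot (x + s *: (y - x) + e *: w) (col i h) = - b i 0.
  by rewrite dotDl dotZl wi mulr0 addr0.
split=> //; apply: IH => j; have [->|ji] := eqVneq j i; first by rewrite pei relaxii.
by rewrite relaxi //; apply/ltW/pe.
Unshelve. all: by end_near. Qed.

Lemma active_tighten b x : geometric_map h -> full_polytope h b -> P_ h b x ->
  active h (tighten b) x = (active h b x :\: virtual h b)%SET.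
Proof.
move=> hg fb Px; apply/finset.setP => i; rewrite finset.in_setD ![i \in active _ _ _]inE mxE.
case: (i \in virtual h b); rewrite ?addr0 //=.
by apply/negbTE; rewrite gt_eqF // (lt_le_trans _ (Px i)) //; lra.
Qed.

Lemma F_tighten b i : geometric_map h -> full_polytope h b ->
  i \notin virtual h b -> F_ h i (tighten b) = F_ h i b.
Proof.
move=> hg fb iv; rewrite /F_ P_tighten //.
by rewrite /tighten !mxE (negPf iv) addr0.
Qed.

Lemma virtual_tighten b : geometric_map h -> full_polytope h b ->
  virtual h (tighten b) = virtual h b.
Proof.
move=> hg fb; apply/finset.setP => i.
have [iv|iv] := boolP (i \in virtual h b); last first.
  by rewrite inE F_tighten //; apply/negbTE; rewrite inE in iv.
apply/negPn/negP => /(virtualPn _ _ hg)[x []]; rewrite P_tighten // => Px.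
by rewrite active_tighten // => /finset.setP/(_ i); rewrite finset.in_setD iv finset.in_set1 eqxx.
Qed.

Lemma Delta_tighten b : geometric_map h -> full_polytope h b ->
  Delta_ h (tighten b) = Delta_ h b.
Proof.
move=> hg fb; rewrite /Delta_ P_tighten //; congr (_ @` _); apply/funext => Q.
rewrite /sigma_ virtual_tighten //; congr (cone_gen _ _).
apply/finset.setP => i; rewrite [LHS]inE [RHS]inE.
have [//|iv /=] := boolP (i \in virtual h b).
by rewrite F_tighten.
Qed.

Lemma full_tighten b : geometric_map h -> full_polytope h b ->
  full_polytope h (tighten b).
Proof. by move=> hg fb; rewrite /full_polytope P_tighten. Qed.

Lemma tight_tighten b : geometric_map h -> full_polytope h b -> tight (tighten b).
Proof.
move=> hg fb x i; rewrite P_tighten // virtual_tighten // => Px iv.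
by rewrite active_tighten // finset.in_setD iv.
Qed.

End FullPolytopes.

(** * The normal fan and the lift of [Gamma] to R^n *)

Section NormalFan.
Context {R : realType} {n d : nat} (h : 'M[R]_(d, n)).
Implicit Types (b w g z : 'cV[R]_n) (x y u : 'cV[R]_d) (A B J : {set 'I_n}).

Local Notation cone J := (cone_gen (fun i => col i h) J).

Lemma sumA_ge J b y : P_ h b y ->
  \sum_(i in J) - b i 0 <= dot (\sum_(i in J) col i h) y.
Proof. by move=> Py; rewrite dot_suml; apply: ler_sum => i _; rewrite dotC Py. Qed.

(** The sum of the normals in J is the linear form exposing the face where J is tight, since it adds
    up nonnegative slacks. *)
Lemma sumA_eq J b y : P_ h b y ->
  dot (\sum_(i in J) col i h) y = \sum_(i in J) - b i 0 <-> J \subset active h b y.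
Proof.
move=> Py; split=> [/eqP|/fintype.subsetP Jy]; last first.
  by rewrite dot_suml; apply: eq_bigr => i /Jy/activeP <-; rewrite dotC.
rewrite dot_suml -subr_eq0 -sumrB psumr_eq0 => [/allP Jy|i iJ]; last first.
  by rewrite subr_ge0 dotC Py.
apply/fintype.subsetP => i iJ; have := Jy i (mem_index_enum i).
by rewrite iJ subr_eq0 /= dotC inE.
Qed.

Lemma cone_minimizer b u x y : P_ h b y -> cone (active h b x) u ->
  dot x u <= dot y u.
Proof.
move=> Py [c [c0 ->]]; rewrite !dot_sumr; apply: ler_sum => i /activeP xi.
by rewrite !dotZr xi ler_wpM2l.
Qed.

(** The sum of the active normals of a vertex x attains its minimum on P_b only at x, while it is
    also minimal at any y whose active cone contains it. Vertices are identified this way below. *)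
Lemma vertex_minimizer b x y : vertex h b x -> P_ h b y ->
  cone (active h b y) (\sum_(i in active h b x) col i h) -> y = x.
Proof.
move=> vx Py yx; apply: (vertex_uniq Py vx); apply/(sumA_eq _ Py)/eqP.
rewrite eq_le sumA_ge // andbT.
have /(sumA_eq _ vx.1) <- : active h b x \subset active h b x by [].
by rewrite !(dotC (\sum_(i in _) _)); apply: cone_minimizer vx.1 _.
Qed.

Lemma face_active J b x : P_ h b x -> J \subset active h b x ->
  face (P_ h b) [set y | P_ h b y /\ J \subset active h b y].
Proof.
move=> Px Jx; split; first by exists x.
exists (\sum_(i in J) col i h), (\sum_(i in J) - b i 0); split.
  by move=> y; apply: sumA_ge.
by apply/seteqP; split=> y [Py /(sumA_eq _ Py) Jy].
Qed.

Lemma Delta_active b x : tight h b -> P_ h b x ->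
  Delta_ h b (cone (active h b x)).
Proof.
move=> tb Px; exists [set y | P_ h b y /\ active h b x \subset active h b y].
  exact: face_active.
rewrite /sigma_; congr (cone_gen _ _); apply/finset.setP => i.
rewrite [LHS]inE; apply/andP/idP => [[_ /asboolP Qi]|ix].
  by apply/activeP; have [|_ ->] := Qi x.
split; first by apply/negP => /(tb _ _ Px); rewrite ix.
apply/asboolP => y [Py /fintype.subsetP xy]; split=> //.
by apply/activeP/xy.
Qed.

Hypothesis hpos : positively_spanning h.

(** Pushing a point of the face Q to a vertex without increasing the form that exposes Q stays in Q,
    so the generators of sigma_Q are active at that vertex. *)
Lemma Delta_inv b s : tight h b -> Delta_ h b s ->
  exists x J, [/\ vertex h b x, J \subset active h b x & s = cone J].
Proof.
move=> tb [Q [[x0 Qx0] [u [c [Pu QE]]]] <-].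
have Px0 : P_ h b x0 by move: Qx0; rewrite QE => -[].
have [x [vx _ xu]] := push hpos u Px0.
exists x; rewrite /sigma_; set J := finset _; exists J; split=> //.
have Qx : Q x.
  rewrite QE; split; first by case: vx.
  apply/eqP; rewrite eq_le Pu ?andbT; last by case: vx.
  by move: Qx0; rewrite QE => -[_ <-]; rewrite !(dotC u).
apply/fintype.subsetP => i; rewrite inE => /andP[_ /asboolP /(_ _ Qx)[_ xi]].
exact/activeP.
Qed.

Lemma support_Delta b : tight h b -> P_ h b !=set0 ->
  Defs.support (Delta_ h b) = setT.
Proof.
move=> tb P0; apply/seteqP; split=> // u _.
have [x [vx xu]] := lp_duality hpos u P0.
by exists (cone (active h b x)) => //; apply: Delta_active => //; case: vx.
Qed.

Definition Gcone b : set 'cV[R]_n :=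
  [set b' | forall x, vertex h b x -> touches h (active h b x) b'].

Definition liftable (D : set (set 'cV[R]_d)) J : set 'cV[R]_n :=
  [set b : 'cV[R]_n | exists phi, [/\ CSF D phi,
     forall j, j \notin J -> phi (col j h) = - b j 0 &
     forall i, i \in J -> - b i 0 <= phi (col i h)]].

(* On the full-dimensional cone of a vertex x, concavity makes the linear form
   of phi an upper bound of phi, hence a point of P_b'. *)
Lemma liftable_touches b b' J x : tight h b -> J \subset virtual h b ->
  liftable (Delta_ h b) J b' -> vertex h b x -> touches h (active h b x) b'.
Proof.
move=> tb /fintype.subsetP JV [phi [[phil phic] phiJ phiJ']] [Px spx].
have P0 : P_ h b !=set0 by exists x.
have [a phia] := phil _ (Delta_active tb Px).
exists a; split=> [l|]; last first.
  apply/fintype.subsetP => i ix; apply/activeP.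
  rewrite -phiJ -?phia //; first exact: cone_gen_mem.
  by apply/negP => /JV /(tb _ _ Px); rewrite ix.
have : phi (col l h) <= dot a (col l h).
  have [g [gx gl]] := spanning_comb (col l h) spx.
  (* Since [|g i 0| + g i 0 >= 0], both w and w + h(e_l) lie in the cone, where phi is the linear
     form a; superadditivity then bounds phi at h(e_l). *)
  pose w := \sum_(i in active h b x) `|g i 0| *: col i h.
  have wx : cone (active h b x) w by exists (fun i => `|g i 0|); split.
  have wlx : cone (active h b x) (w + col l h).
    apply/cone_genP; exists (fun i => `|g i 0| + g i 0); split=> [i|i ix|].
    - by rewrite -lerBlDr sub0r -normrN ler_norm.
    - by rewrite gx // normr0 addr0.
    - rewrite gl mulmx_col /w big_mkcond -big_split; apply: eq_bigr => i _.
      rewrite scalerDl; case: ifPn => // /gx ->; by rewrite normr0 scale0r.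
  have := phic w (col l h); rewrite support_Delta // => /(_ I I I).
  by rewrite (phia _ wx) (phia _ wlx) dotDr lerD2l.
apply: le_trans; have [lJ|lJ] := boolP (l \in J); first exact: phiJ'.
by rewrite phiJ.
Qed.

(** The function is phi(u) = min of <y, u> over y in P_b', the support function up to sign. It is
    superadditive as a minimum of linear forms, and linear on the cone of a vertex x because the
    point touching the active set of x minimizes every u of that cone. *)
Lemma touches_liftable b b' : geometric_map h -> tight h b -> P_ h b !=set0 ->
  Gcone b b' -> liftable (Delta_ h b) (virtual h b) b'.
Proof.
move=> hg tb P0 Gb'.
have /choice[p pP] u : exists p, P_ h b' p /\ forall y, P_ h b' y -> dot p u <= dot y u.
  have [x [vx xu]] := lp_duality hpos u P0; have [p [Pp xp]] := Gb' _ vx.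
  exists p; split=> // y Py; apply: cone_minimizer => //.
  exact: cone_genS xp _ xu.
have pE x a u : vertex h b x -> P_ h b' a -> active h b x \subset active h b' a ->
    cone (active h b x) u -> dot (p u) u = dot a u.
  move=> vx Pa xa xu; have [Pp pmin] := pP u.
  by apply/eqP; rewrite eq_le pmin //= (cone_minimizer Pp) //; apply: cone_genS xu.
exists (fun u => dot (p u) u); split.
- split=> [s /(Delta_inv tb)[x [J [vx Jx ->]]]|u v _ _ _].
    have [a [Pa xa]] := Gb' _ vx; exists a => u Ju.
    exact: pE vx Pa xa (cone_genS Jx Ju).
  have [Pp _] := pP (u + v); rewrite dotDr.
  by apply: lerD; [have [_] := pP u|have [_] := pP v]; apply.
- move=> j /(virtualPn _ _ hg)[x0 [Px0 ax0]].
  have [x [vx x0x _]] := push hpos 0 Px0; have [a [Pa xa]] := Gb' _ vx.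
  have jx : j \in active h b x.
    by apply: (fintype.subsetP x0x); rewrite ax0 finset.in_set1.
  rewrite (pE _ _ _ vx Pa xa (cone_gen_mem _ jx)).
  by apply/activeP/(fintype.subsetP xa).
- by move=> i _; have [Pp _] := pP (col i h); apply: Pp.
Qed.

Lemma liftable_Gcone b : geometric_map h -> tight h b -> P_ h b !=set0 ->
  liftable (Delta_ h b) (virtual h b) = Gcone b.
Proof.
move=> hg tb P0; apply/seteqP; split=> b'; last exact: touches_liftable.
by move=> lb' x; apply: liftable_touches lb'.
Qed.

Lemma Gcone_refl b : Gcone b b.
Proof. by move=> x [Px _]; exists x; split. Qed.

Lemma touches_translate A b y : touches h A b -> touches h A (b + h^T *m y).
Proof.
move=> [x [Px /fintype.subsetP Ax]]; exists (x - y); split=> [i|].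
  by rewrite mxE opprD dotBl -dot_col lerD2r.
by apply/fintype.subsetP => i /Ax/activeP xi; apply/activeP; rewrite mxE opprD dotBl -dot_col xi.
Qed.

Section Gale.
Variable k : 'M[R]_(n, n - d).
Hypothesis k_gale : gale_transform h k.

Lemma gale_mul0 : h *m k = 0.
Proof.
apply/matrixP => i j; rewrite [RHS]mxE; have [_ kP] := k_gale.
have /matrixP/(_ i 0) : h *m (k *m (delta_mx j 0 : 'cV_(n - d))) = 0.
  by apply/kP; exists (delta_mx j 0).
by rewrite mulmxA -colE !mxE.
Qed.

(** Every g in ker h has the form k t and so pairs to zero with b; the Fredholm alternative
    applies. *)
Lemma gale_kernel b : k^T *m b = 0 -> exists y, b = h^T *m y.
Proof.
move=> kb; apply: fredholm => g; rewrite trmxK => hg.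
have [_ /(_ g)[/(_ hg)[t ->]] _] := k_gale.
by rewrite dot_mulmxl kb dot0r.
Qed.

Lemma gale_surj (v : 'cV[R]_(n - d)) : exists b, v = k^T *m b.
Proof.
apply: fredholm => t; rewrite trmxK => kt; have [kinj _] := k_gale.
by rewrite (kinj t 0) ?dot0l //= kt mulmx0.
Qed.

Lemma Gamma_mem b b' : geometric_map h -> tight h b -> P_ h b !=set0 ->
  Gamma h k (Delta_ h b) (virtual h b) (k^T *m b') <-> Gcone b b'.
Proof.
move=> hg tb P0; rewrite -(liftable_Gcone hg tb P0); split=> [|lb]; last by exists b'.
move=> [b'' lb'' /esym/eqP]; rewrite -subr_eq0 -mulmxBr => /eqP/gale_kernel[y /eqP].
rewrite subr_eq addrC => /eqP ->; move: lb''.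
rewrite -/(liftable _ _) liftable_Gcone // => Gb'' x vx.
exact/touches_translate/Gb''.
Qed.

End Gale.
End NormalFan.

(** * Perturbations of b, and chambers as cones of simple polytopes *)

Section Chambers.
Context {R : realType} {n d : nat} (h : 'M[R]_(d, n)).
Implicit Types (b w g z : 'cV[R]_n) (x y u : 'cV[R]_d) (A B J : {set 'I_n}).

Lemma touches_dot A b g : h *m g = 0 -> (forall i, i \notin A -> g i 0 = 0) ->
  touches h A b -> dot g b = 0.
Proof.
move=> hg gA [x [_ /fintype.subsetP Ax]]; rewrite (relation_slack b x hg).
rewrite big1 // => i _; have [/Ax/activeP ->|/gA ->] := boolP (i \in A).
  by rewrite subrr mulr0.
by rewrite mul0r.
Qed.

(* The point touching A is an affine function of the parameter, since A spans. *)
Lemma near_touches A b w : spanning h A ->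
  \forall e \near 0^'+, touches h A (b + e *: w) -> touches h A b.
Proof.
move=> sA; suff [e0 e00 He] : exists2 e0, 0 < e0 &
    forall e, 0 < e -> e < e0 -> touches h A (b + e *: w) -> touches h A b.
  near=> e; apply: He; last by near: e; apply: nbhs_right_lt.
  by near: e; apply: nbhs_right_gt.
apply: contrapT => no.
have small e0 : 0 < e0 -> exists e, [/\ 0 < e, e < e0 & touches h A (b + e *: w)].
  move=> e00; apply: contrapT => no'; apply: no; exists e0 => // e e1 e2 te.
  by case: no'; exists e.
have nb : ~ touches h A b by move=> tb; apply: no; exists 1.
have [e1 [e10 _ [x1 [Px1 /fintype.subsetP Ax1]]]] := small 1 ltr01.
have [e2 [e20 e21 [x2 [Px2 /fintype.subsetP Ax2]]]] := small _ e10.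
(* The touching point at parameter e is x + e y, with x and y interpolated from the parameters e1
   and e2. The claim is that its value x at e = 0 satisfies every inequality. *)
pose y := (e1 - e2)^-1 *: (x1 - x2); pose x := x1 - e1 *: y.
have e12 : e1 - e2 != 0 by rewrite subr_eq0 gt_eqF.
have yA i : i \in A -> dot y (col i h) = - w i 0.
  move=> iA; have /activeP := Ax1 _ iA; have /activeP := Ax2 _ iA.
  rewrite dotZl dotBl !mxE => -> ->; rewrite -[RHS](mulKf e12); congr (_ * _); ring.
have xA i : i \in A -> dot x (col i h) = - b i 0.
  move=> iA; rewrite dotBl dotZl yA //; have /activeP -> := Ax1 _ iA.
  by rewrite !mxE; ring.
apply: nb; exists x; split; last by apply/fintype.subsetP => i /xA xi; apply/activeP.
move=> i; rewrite leNgt; apply/negP => xi.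
have : 0 < - b i 0 - dot x (col i h) by rewrite subr_gt0.
move=> /(near_affine_gt0 (- w i 0 - dot y (col i h))) H.
have [e0 e00 He0] : exists2 e0, 0 < e0 & forall e, 0 < e -> e < e0 ->
    0 < - b i 0 - dot x (col i h) + e * (- w i 0 - dot y (col i h)).
  move: H => [e0 /= e00 He]; exists e0 => // e e1' e2'; apply: He => //=.
  by rewrite sub0r normrN gtr0_norm.
have [e [e1' e2' [x' [Px' /fintype.subsetP Ax']]]] := small _ e00.
have x'E : x' = x + e *: y.
  apply/eqP; rewrite -subr_eq0; apply/eqP/sA => j jA.
  have /activeP := Ax' _ jA; rewrite dotBl dotDl dotZl xA // yA // => ->.
  by rewrite !mxE; ring.
have := Px' i; have := He0 _ e1' e2'; rewrite x'E dotDl (dotZl e y) !mxE; lra.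
Unshelve. all: by end_near. Qed.

(** The active set of a vertex is spanning, so [near_touches] applies to it, simultaneously for the
    finitely many candidates: vertices of the perturbed polytope specialize to vertices of P_b. *)
Lemma near_vertex b w : \forall e \near 0^'+, forall x', vertex h (b + e *: w) x' ->
  exists2 x, vertex h b x & active h (b + e *: w) x' \subset active h b x.
Proof.
have H : \forall e \near 0^'+, forall A, spanning h A ->
    touches h A (b + e *: w) -> touches h A b.
  apply: near_forall_fin => A; have [sA|nsA] := pselect (spanning h A); last by near=> e.
  by have := near_touches b w sA => H; near=> e => _; near: e.
near=> e => x' [Px' sx'].
have He : forall A, spanning h A -> touches h A (b + e *: w) -> touches h A b.
  by near: e.
have [x [Px x'x]] : touches h (active h (b + e *: w) x') b.
  by apply: He sx' _; exists x'.
by exists x => //; split=> //; apply: spanningS sx'.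
Unshelve. all: by end_near. Qed.

(** Independence makes <y, h(e_i)> = - w_i solvable on the active set, whose tightness is then
    followed along x + e y while the other inequalities remain strict. *)
Lemma near_touches_independent b w x : P_ h b x -> independent h (active h b x) ->
  \forall e \near 0^'+, exists x', P_ h (b + e *: w) x' /\
    active h (b + e *: w) x' = active h b x.
Proof.
move=> Px ix; have [y yw] := independent_solve (- w) ix.
have H : \forall e \near 0^'+, forall i, i \notin active h b x ->
    - (b + e *: w) i 0 < dot (x + e *: y) (col i h).
  apply: near_forall_fin => i; have [ia|ia] := boolP (i \in active h b x).
    by near=> e.
  by have := near_slack w y (active_lt Px ia) => H; near=> e => _; near: e.
near=> e; have He : forall i, i \notin active h b x ->
    - (b + e *: w) i 0 < dot (x + e *: y) (col i h) by near: e.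
have xe i : i \in active h b x -> dot (x + e *: y) (col i h) = - (b + e *: w) i 0.
  move=> ia; have /activeP := ia; rewrite dotDl dotZl yw // => ->.
  by rewrite !mxE; ring.
exists (x + e *: y); split=> [i|].
  by have [/xe ->|/He/ltW] := boolP (i \in active h b x).
apply/finset.setP => i; apply/activeP/idP => [xi|]; last exact: xe.
by apply/negPn/negP => /He; rewrite xi ltxx.
Unshelve. all: by end_near. Qed.

Definition simple b : Prop :=
  forall x, vertex h b x -> independent h (active h b x).

Lemma near_simple_Gcone b w : simple b ->
  \forall e \near 0^'+, Gcone h b (b + e *: w).
Proof.
(* Quantifying over active sets instead of vertices makes the common choice of e a finite one. *)
move=> sb; have H : \forall e \near 0^'+, forall A,
    (exists x, vertex h b x /\ active h b x = A) -> touches h A (b + e *: w).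
  apply: near_forall_fin => A.
  have [[x [vx xA]]|no] := pselect (exists x, vertex h b x /\ active h b x = A);
    last by near=> e.
  have := near_touches_independent w (proj1 vx) (sb _ vx) => H.
  near=> e => _; have [x' [Px' ax']] : exists x', P_ h (b + e *: w) x' /\
    active h (b + e *: w) x' = active h b x by near: e.
  by exists x'; split=> //; rewrite ax' xA.
near=> e => x vx; have He : forall A,
  (exists x, vertex h b x /\ active h b x = A) -> touches h A (b + e *: w) by near: e.
by apply: He; exists x.
Unshelve. all: by end_near. Qed.

Hypothesis hgeom : geometric_map h.

Lemma full_positively_spanning b : full_polytope h b -> positively_spanning h.
Proof. by case/(full_polytopeP _ hgeom). Qed.

Lemma full_nonempty b : full_polytope h b -> P_ h b !=set0.
Proof. by case/(full_polytopeP _ hgeom) => _ [x xb]; exists x => i; apply/ltW. Qed.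

Lemma near_full b w : full_polytope h b ->
  \forall e \near 0^'+, full_polytope h (b + e *: w).
Proof.
move=> fb; have hpos := full_positively_spanning fb.
have [_ [x xb]] := (full_polytopeP _ hgeom).1 fb.
have H : \forall e \near 0^'+, forall i, - (b + e *: w) i 0 < dot (x + e *: 0) (col i h).
  by apply: near_forall_fin => i; apply: near_slack.
near=> e; apply/(full_polytopeP _ hgeom); split=> //.
by exists (x + e *: 0); near: e.
Unshelve. all: by end_near. Qed.

Variable k : 'M[R]_(n, n - d).
Hypothesis k_gale : gale_transform h k.

Lemma face_refl (m : nat) (C : set 'cV[R]_m) : C !=set0 -> face C C.
Proof.
move=> C0; split=> //; exists 0, 0; split=> [x _|]; first by rewrite dot0l.
by apply/seteqP; split=> x // Cx; [split=> //; rewrite dot0l|case: Cx].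
Qed.

Lemma secondary_Gamma b : full_polytope h b ->
  secondary_fan h k (Gamma h k (Delta_ h b) (virtual h b)).
Proof.
move=> fb; exists b, (virtual h b); split=> //; apply: face_refl.
have hpos := full_positively_spanning fb.
have ft := full_tighten hgeom fb.
exists (k^T *m tighten h b); rewrite -(Delta_tighten hgeom fb) -(virtual_tighten hgeom fb).
apply/(Gamma_mem hpos k_gale _ hgeom (tight_tighten hgeom fb) (full_nonempty ft)).
exact: Gcone_refl.
Qed.

(** Let g be a relation on the active set of a vertex, and c = b + e g. Vertices of P_c specialize
    to vertices of P_b, so the cone of c contains that of b, and maximality makes them equal. Then c
    also touches that active set, so <g, c> = 0 = <g, b>, whence <g, g> = 0. *)
Lemma chamber_simple b : full_polytope h b -> tight h b ->
  chamber h k (Gamma h k (Delta_ h b) (virtual h b)) -> simple b.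
Proof.
move=> fb tb [_ Cmax] x vx g hg gx; apply/eqP/negPn/negP => g0.
have hpos := full_positively_spanning fb.
have [e e0 [fe ve]] := near_witness (filterI (near_full g fb) (near_vertex b g)).
set c := b + e *: g in fe ve; pose c' := tighten h c.
have fc' := full_tighten hgeom fe; have tc' := tight_tighten hgeom fe.
have cc' y : P_ h c' y -> active h c' y \subset active h c y.
  by rewrite P_tighten // => Py; rewrite active_tighten //; apply: subsetDl.
have Gc' : Gcone h b `<=` Gcone h c'.
  move=> a Ga y [Py sy]; have [|v vv yv] := ve y.
    by split; [move: Py; rewrite P_tighten|apply: spanningS (cc' _ Py) sy].
  have [p [Pp vp]] := Ga _ vv; exists p; split=> //.
  exact: fintype.subset_trans (cc' _ Py) (fintype.subset_trans yv vp).
have GammaE a : Gamma h k (Delta_ h c) (virtual h c) (k^T *m a) <-> Gcone h c' a.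
  rewrite -(Delta_tighten hgeom fe) -(virtual_tighten hgeom fe).
  exact: Gamma_mem (full_nonempty fc').
have sub : Gamma h k (Delta_ h b) (virtual h b) `<=` Gamma h k (Delta_ h c) (virtual h c).
  move=> _ [a la <-]; apply/GammaE/Gc'.
  by apply/(Gamma_mem hpos k_gale _ hgeom tb (full_nonempty fb)); exists a.
have Gcc : Gcone h c' c.
  move=> y [Py _]; exists y; split; last exact: cc'.
  by move: Py; rewrite P_tighten.
have Gbc : Gcone h b c.
  apply/(Gamma_mem hpos k_gale _ hgeom tb (full_nonempty fb)).
  by rewrite -(Cmax _ (secondary_Gamma fe) sub); apply/GammaE.
have := touches_dot hg gx (Gbc _ vx); rewrite dotDr dotZr.
rewrite (touches_dot hg gx (Gcone_refl vx)) add0r => /eqP.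
by rewrite mulf_eq0 gt_eqF //= dot_eq0 (negPf g0).
Qed.

(** Let a cone of the secondary fan, coming from b2, contain that of b. For a vertex x of P_b take
    the vertex x2 of P_b2 whose cone contains the sum of the active normals of x. Some p in P_b
    touches the active set of x2 and minimizes that sum, so p = x; a spanning set inside an
    independent one equals it, so x and x2 have the same active set. The larger cone thus satisfies
    the conditions defining the smaller. *)
Lemma simple_chamber b : full_polytope h b -> tight h b -> simple b ->
  chamber h k (Gamma h k (Delta_ h b) (virtual h b)).
Proof.
move=> fb tb sb; split; first exact: secondary_Gamma.
move=> t [b2 [J [fb2 JV [_ [u [c [_ tE]]]]]]] Gt.
have hpos := full_positively_spanning fb.
have Gmem a := Gamma_mem hpos k_gale a hgeom tb (full_nonempty fb).
apply/seteqP; split=> //; rewrite tE => _ [[a la <-] _].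
apply/Gmem => x vx; pose b2' := tighten h b2.
have fb2' := full_tighten hgeom fb2; have tb2' := tight_tighten hgeom fb2.
have JV' : J \subset virtual h b2' by rewrite virtual_tighten.
rewrite -/(liftable h _ _) -(Delta_tighten hgeom fb2) in la.
have [x2 [vx2 x2w]] := lp_duality hpos (\sum_(i in active h b x) col i h) (full_nonempty fb2').
suff x2x : active h b2' x2 = active h b x.
  by rewrite -x2x; apply: liftable_touches la vx2.
apply: (active_independent_sub (proj2 vx2) _ (sb _ vx)).
have [a' la' a'E] : Gamma h k (Delta_ h b2) J (k^T *m b).
  by have /Gt := (Gmem b).2 (@Gcone_refl _ _ _ h b); rewrite tE => -[].
rewrite -/(liftable h _ _) -(Delta_tighten hgeom fb2) in la'.
have [p [Pp x2p]] : touches h (active h b2' x2) b.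
  have /(gale_kernel k_gale)[y /eqP] : k^T *m (b - a') = 0 by rewrite mulmxBr a'E subrr.
  rewrite subr_eq addrC => /eqP ->; apply: touches_translate.
  exact: liftable_touches la' vx2.
suff <- : p = x by [].
by apply: vertex_minimizer vx Pp _; apply: cone_genS x2w.
Qed.

End Chambers.

(** * Normal fans of simple polytopes are simplicial quantum fans *)

Section SimplicialFans.
Context {R : realType} {n d : nat} (h : 'M[R]_(d, n)).
Implicit Types (b w g z : 'cV[R]_n) (x y u : 'cV[R]_d) (A B J : {set 'I_n}).

Local Notation cone J := (cone_gen (fun i => col i h) J).

Lemma polyhedral_cone_gen (m r : nat) (v : 'I_r -> 'cV[R]_m) (K : {set 'I_r}) :
  polyhedral_cone (cone_gen v K).
Proof.
exists r, (fun i => if i \in K then v i else 0); apply/seteqP; split=> x [c [c0 ->]];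
  exists c; split=> //.
  rewrite big_mkcond; apply: eq_big => i; first by rewrite inE.
  by move=> _; case: ifP => //; rewrite scaler0.
rewrite [RHS]big_mkcond; apply: eq_big => i; first by rewrite inE.
by move=> _; case: ifP => //; rewrite scaler0.
Qed.

Lemma face_coneE (m r : nat) (v : 'I_r -> 'cV[R]_m) (K : {set 'I_r}) F :
  face (cone_gen v K) F <-> exists2 u, (forall i, i \in K -> 0 <= dot u (v i)) &
    F = [set x | cone_gen v K x /\ dot u x = 0].
Proof.
split=> [[[p Fp] [u [c [uc FE]]]]|[u u0 FE]].
  have c0 : c = 0.
    move: Fp; rewrite FE => -[Kp up]; apply/eqP; rewrite eq_le.
    have := uc _ (cone_genZ (ler0n _ 2) Kp); rewrite dotZr up.
    have := uc _ (cone_gen0 v K); rewrite dot0r; lra.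
  exists u; last by rewrite FE c0.
  by move=> i iK; rewrite -c0; apply: uc; apply: cone_gen_mem.
split; first by exists 0; rewrite FE; split; [exact: cone_gen0|rewrite dot0r].
exists u, 0; split=> // x [e [e0 ->]]; rewrite dot_sumr; apply: sumr_ge0 => i iK.
by rewrite dotZr mulr_ge0 // u0.
Qed.

Lemma face_cone_gen (m r : nat) (v : 'I_r -> 'cV[R]_m) (K : {set 'I_r}) (u : 'cV[R]_m) :
  (forall i, i \in K -> 0 <= dot u (v i)) ->
  [set x | cone_gen v K x /\ dot u x = 0] =
  cone_gen v [set i in K | dot u (v i) == 0]%SET.
Proof.
move=> u0; apply/seteqP; split=> [x [/cone_genP[c [c0 cK ->]] /eqP]|x Kx].
  rewrite dot_sumr psumr_eq0 => [/allP cu|i _]; last first.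
    rewrite dotZr; have [iK|/cK ->] := boolP (i \in K); last by rewrite mul0r.
    by rewrite mulr_ge0 // u0.
  apply/cone_genP; exists c; split=> // i; rewrite inE negb_and => /orP[/cK//|/negPf ui].
  have := cu i (mem_index_enum i); rewrite dotZr mulf_eq0 ui orbF => /eqP //.
split; first by apply: cone_genS Kx; apply/fintype.subsetP => i; rewrite inE => /andP[].
case: Kx => c [_ ->]; rewrite dot_sumr big1 // => i; rewrite inE => /andP[_ /eqP ui].
by rewrite dotZr ui mulr0.
Qed.

Lemma independent_coef A (c e : 'I_n -> R) : independent h A ->
  (forall i, i \notin A -> c i = 0) -> (forall i, i \notin A -> e i = 0) ->
  \sum_i c i *: col i h = \sum_i e i *: col i h -> c =1 e.
Proof.
move=> iA cA eA ce i; apply/eqP; rewrite -subr_eq0; apply/eqP.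
have := iA (\col_i (c i - e i)) _ _; rewrite mulmx_col.
under eq_bigr do rewrite mxE scalerBl.
rewrite sumrB ce subrr => /(_ erefl)H.
have /matrixP/(_ i 0) : \col_i (c i - e i) = 0.
  by apply: H => j jA; rewrite mxE cA // eA // subrr.
by rewrite !mxE.
Qed.

Lemma strongly_convex_cone A : independent h A -> strongly_convex (cone A).
Proof.
move=> iA x /cone_genP[c [c0 cA xc]] /cone_genP[e [e0 eA xe]].
have ce : c =1 (fun i => - e i).
  apply: (independent_coef iA) => // [i /eA ->|]; first by rewrite oppr0.
  by rewrite -xc -[x]opprK xe -sumrN; apply: eq_bigr => i _; rewrite scaleNr.
rewrite xc big1 // => i _; suff -> : c i = 0 by rewrite scale0r.
have := c0 i; have := e0 i; rewrite ce; lra.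
Qed.

(** The supporting form is found by solving for the values 0 on J and 1 on A \ J. *)
Lemma face_independent A J : independent h A -> J \subset A ->
  face (cone A) (cone J).
Proof.
move=> iA /fintype.subsetP JA.
have [u uw] := independent_solve (\col_i (i \notin J)%:R) iA.
have uA i : i \in A -> dot u (col i h) = (i \notin J)%:R by move=> /uw ->; rewrite mxE.
apply/face_coneE; exists u; first by move=> i /uA ->; rewrite ler0n.
rewrite face_cone_gen => [|i /uA ->]; last by rewrite ler0n.
congr (cone_gen _ _); apply/finset.setP => i; rewrite [RHS]inE.
have [iA'|iA'] := boolP (i \in A); last by apply/negbTE; apply: contra iA' => /JA.
by rewrite uA //= pnatr_eq0 eqb0 negbK.
Qed.

Lemma cone_set1 i : cone [set i]%SET = ray_of h i.
Proof.
apply/seteqP; split=> x [c [c0 ->]].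
  by rewrite big_set1; exists (c i).
by exists (fun=> c); split=> //; rewrite big_set1.
Qed.

(** Affine independence passes to the coefficients, which live in R^1 and allow at most two points;
    0 and h(e_i) are two such points. *)
Lemma affdim_ray i : col i h != 0 -> affdim (ray_of h i) = 1.
Proof.
move=> i0; apply/eqP; rewrite eq_le; apply/andP; split.
  have [r [x [rx xfree ->]]] := affdim_witness (ray_of h i).
  have /choice[a aP] : forall j, exists a : R, x j = a *: col i h.
    by move=> j; have [a [_ ->]] := rx j; exists a.
  have : affinely_independent (fun j => const_mx (a j) : 'cV[R]_1).
    move=> c c1 ca; apply: xfree => //; under eq_bigr do rewrite aP scalerA.
    rewrite -scaler_suml -[RHS](scale0r (col i h)); congr (_ *: _).
    transitivity ((\sum_j c j *: const_mx (a j) : 'cV[R]_1) 0 0); last by rewrite ca mxE.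
    by rewrite summxE; apply: eq_bigr => j _; rewrite !mxE.
  by move=> /affinely_independent_leq; lia.
pose x (j : 'I_2) := (j : nat)%:R *: col i h.
rewrite (_ : 1 = 2%:Z - 1) //; apply: (@affdim_ge _ _ _ 2 x).
  by move=> j; exists (j : nat)%:R; rewrite ler0n.
move=> c; rewrite !big_ord_recl !big_ord0 !addr0 /x scale0r scaler0 add0r scale1r.
move=> c1 /eqP; rewrite scaler_eq0 (negPf i0) orbF => /eqP cj.
move=> j; have [l ->|->] := unliftP ord0 j; first by rewrite (ord1 l).
by move: c1; rewrite cj addr0.
Qed.

Lemma affdim_cone0 : affdim (cone finset.set0) <> 1.
Proof.
have [r [x [rx xfree ->]]] := affdim_witness (cone finset.set0).
have : affinely_independent (fun j : 'I_r => 0 : 'cV[R]_0).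
  move=> c c1 _; apply: xfree => //; rewrite big1 // => j _.
  by have [e [_ ->]] := rx j; rewrite big_set0 scaler0.
by move=> /affinely_independent_leq; lia.
Qed.

Lemma affdim_cone2 A i j : geometric_map h -> i \in A -> j \in A -> i != j ->
  1 < affdim (cone A).
Proof.
move=> [h0 hg] iA jA ij.
pose x (l : 'I_3) := nth 0 [:: 0; col i h; col j h] l.
suff : 3%:Z - 1 <= affdim (cone A) by lia.
apply: (@affdim_ge _ _ _ 3 x) => [[[|[|[|]]] //= ?]|c].
- exact: cone_gen0.
- exact: cone_gen_mem.
- exact: cone_gen_mem.
rewrite !big_ord_recl !big_ord0 !addr0 /x /= scaler0 add0r.
set c0 := c ord0; set c1 := c (lift _ _); set c2 := c (lift _ _) => c012 cij.
have c20 : c2 = 0.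
  apply/eqP/negPn/negP => c20; have /eqP := hg i j ij (- (c2^-1 * c1)); apply.
  apply: (scalerI c20); rewrite scaleNr scalerN scalerA mulVKf //.
  by apply/eqP; rewrite -addr_eq0 addrC cij.
have c10 : c1 = 0.
  by move: cij; rewrite c20 scale0r addr0 => /eqP; rewrite scaler_eq0 (negPf (h0 i)) orbF => /eqP.
have c00 : c0 = 0 by move: c012; rewrite c10 c20 !addr0.
move=> l; have [l' ->|->] := unliftP ord0 l; last exact: c00.
have [l'' ->|->] := unliftP ord0 l'; last exact: c10.
by rewrite (ord1 l''); apply: c20.
Qed.

Hypothesis hgeom : geometric_map h.
Variable b : 'cV[R]_n.
Hypotheses (fb : full_polytope h b) (tb : tight h b) (sb : simple h b).

(** At a simple vertex the active inequalities outside J can be loosened while those of J stay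
    tight, so J is the active set of a nearby point. *)
Lemma simple_Delta x J : vertex h b x -> J \subset active h b x ->
  Delta_ h b (cone J).
Proof.
move=> vx Jx; have [y yw] := independent_solve (\col_i (i \notin J)%:R) (sb vx).
have yA i : i \in active h b x -> dot y (col i h) = (i \notin J)%:R.
  by move=> /yw ->; rewrite mxE.
have H : \forall e \near 0^'+, forall i, i \notin active h b x ->
    - b i 0 < dot (x + e *: y) (col i h).
  apply: near_forall_fin => i; have [ia|ia] := boolP (i \in active h b x).
    by near=> e.
  by have := near_slack0 y (active_lt (proj1 vx) ia) => H; near=> e => _; near: e.
have [e e0 He] := near_witness H.
have xe i : i \in active h b x -> dot (x + e *: y) (col i h) = - b i 0 + e * (i \notin J)%:R.
  by move=> ia; rewrite dotDl dotZl yA //; have /activeP -> := ia.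
have Pxe : P_ h b (x + e *: y).
  move=> i; have [ia|/He/ltW//] := boolP (i \in active h b x).
  by rewrite xe // lerDl mulr_ge0 // ltW.
rewrite (_ : J = active h b (x + e *: y)); first exact: Delta_active.
apply/finset.setP => i; apply/idP/activeP => [iJ|].
  by rewrite xe ?iJ ?mulr0 ?addr0 //; apply: (fintype.subsetP Jx).
have [ia|/He xi xi'] := boolP (i \in active h b x); last by rewrite xi' ltxx in xi.
rewrite xe // => /eqP; rewrite addrC -subr_eq0 addrK mulf_eq0 gt_eqF //=.
by rewrite pnatr_eq0 eqb0 negbK.
Unshelve. all: by end_near. Qed.

(* A point of both cones is minimized on P_b at both vertices, so that its
   coefficients vanish outside the common active set. *)
Lemma cone_capE x x' J J' : vertex h b x -> vertex h b x' ->
  J \subset active h b x -> J' \subset active h b x' ->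
  cone J `&` cone J' = cone (J :&: J')%SET.
Proof.
move=> vx vx' Jx J'x'; apply/seteqP; split=> [p [Jp J'p]|p JJp]; last first.
  by split; apply: cone_genS JJp; [apply: subsetIl|apply: subsetIr].
have vanish y y' (K : {set 'I_n}) c : vertex h b y -> vertex h b y' -> K \subset active h b y ->
    cone (active h b y') p -> (forall i, 0 <= c i) -> (forall i, i \notin K -> c i = 0) ->
    p = \sum_i c i *: col i h -> forall i, i \notin active h b y' -> c i = 0.
  move=> vy vy' Ky y'p c0 cK pc i iy'.
  have : dot y' p <= dot y p by apply: cone_minimizer y'p; case: vy.
  rewrite -subr_ge0 -dotBl pc dot_sumr.
  have nonpos j : dot (y - y') (c j *: col j h) <= 0.
    rewrite dotZr; have [/(fintype.subsetP Ky)/activeP yj|/cK ->] := boolP (j \in K).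
      by rewrite dotBl yj mulr_ge0_le0 // subr_le0; case: vy' => + _; apply.
    by rewrite mul0r.
  rewrite -oppr_le0 -sumrN => sum_le0.
  have : \sum_j - dot (y - y') (c j *: col j h) == 0.
    by rewrite eq_le sum_le0 sumr_ge0 // => j _; rewrite oppr_ge0.
  rewrite psumr_eq0 => [/allP /(_ i (mem_index_enum i))|j _]; last by rewrite oppr_ge0.
  rewrite oppr_eq0 dotZr mulf_eq0 => /orP[/eqP//|]; rewrite dotBl subr_eq0 => /eqP yy'.
  apply: cK; apply: contra iy' => /(fintype.subsetP Ky)/activeP yi; apply/activeP.
  by rewrite -yy'.
have Kx := cone_genS Jx Jp; have Kx' := cone_genS J'x' J'p.
case/cone_genP: Jp => c [c0 cJ pc]; case/cone_genP: J'p => e [e0 eJ' pe].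
have cx' := vanish _ _ _ _ vx vx' Jx Kx' c0 cJ pc.
have ex := vanish _ _ _ _ vx' vx J'x' Kx e0 eJ' pe.
have ce : c =1 e.
  apply: (independent_coef (sb vx)) => //; last by rewrite -pc.
  by move=> i ix; apply: cJ; apply: contra ix => /(fintype.subsetP Jx).
apply/cone_genP; exists c; split=> // i; rewrite finset.in_setI negb_and.
by case/orP => [/cJ//|/eJ']; rewrite ce.
Qed.

(** Applied to the fan across the wall, which has to be proved a fan. By simplicity its cones are
    exactly the cones on subsets of active sets of vertices, and faces and intersections are
    computed on index sets. *)
Lemma simple_quantum_fan : quantum_fan h (Delta_ h b) (virtual h b).
Proof.
have hpos := full_positively_spanning hgeom fb.
split; last first.
  apply/seteqP; split=> s.
    move=> [/(Delta_inv hpos tb)[x [J [vx Jx ->]]] dimJ].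
    have [i iJ] : exists i, i \in J.
      apply/finset.set0Pn; apply/negP => /eqP J0; move: dimJ; rewrite J0.
      exact: affdim_cone0.
    have JE : J = [set i]%SET.
      apply/eqP; rewrite finset.eqEsubset finset.sub1set iJ andbT; apply/fintype.subsetP => j jJ.
      rewrite inE; apply/negPn/negP => ji.
      by have := affdim_cone2 hgeom jJ iJ ji; rewrite dimJ ltxx.
    exists i; last by rewrite JE cone_set1.
    apply/negP => /(tb (proj1 vx)); rewrite (fintype.subsetP Jx) //.
  move=> [i iv <-]; split; last by apply: affdim_ray; case: hgeom.
  have [x0 [Px0 ax0]] := (virtualPn _ _ hgeom).1 iv.
  have [x [vx x0x _]] := push hpos 0 Px0.
  by rewrite -cone_set1; apply: (simple_Delta vx); rewrite -ax0.
split.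
- apply: (@sub_finite_set _ _ [set cone J | J in setT]).
    by move=> s /(Delta_inv hpos tb)[x [J [_ _ ->]]]; exists J.
  by apply: finite_image; exact: finite_finset.
- move=> s /(Delta_inv hpos tb)[x [J [vx Jx ->]]]; split; first exact: polyhedral_cone_gen.
  by apply: strongly_convex_cone; apply: independentS (sb vx).
- move=> s t /(Delta_inv hpos tb)[x [J [vx Jx ->]]] /face_coneE[u u0 ->].
  rewrite face_cone_gen //; apply: simple_Delta vx _.
  by apply: fintype.subset_trans Jx; apply/fintype.subsetP => i; rewrite inE => /andP[].
- move=> s t /(Delta_inv hpos tb)[x [J [vx Jx ->]]] /(Delta_inv hpos tb)[x' [J' [vx' Jx' ->]]].
  rewrite (cone_capE vx vx' Jx Jx'); split; apply: face_independent.
  + exact: independentS (sb vx).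
  + exact: subsetIl.
  + exact: independentS (sb vx').
  + exact: subsetIr.
Qed.

End SimplicialFans.

(** The generators v of the simplicial cone are unknown. But each ray of h(e_i) is a cone of the
    fan, hence a face of the cone on A, and must contain some v_l. The map from i to l is injective
    since no two h(e_i) are proportional, and a relation between the h(e_i) becomes one between the
    v_l. *)
Lemma simplicial_independent {R : realType} {n d : nat} (h : 'M[R]_(d, n)) D
    (A : {set 'I_n}) : geometric_map h -> fan D ->
  D (cone_gen (fun i => col i h) A) -> (forall i, i \in A -> D (ray_of h i)) ->
  simplicial_cone (cone_gen (fun i => col i h) A) -> independent h A.
Proof.
move=> [h0 hg] [_ _ _ Dcap] DA Dray [r [v [vfree Av]]] g hgr gA.
have ray i : i \in A -> exists lc : 'I_r * R, col i h = lc.2 *: v lc.1.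
  move=> iA; have [+ _] := Dcap _ _ DA (Dray i iA).
  have -> : cone_gen (fun i => col i h) A `&` ray_of h i = ray_of h i.
    apply: setIidr => x [a [a0 ->]]; apply: cone_genZ => //.
    exact: cone_gen_mem.
  rewrite Av => /face_coneE[u u0 rE].
  have : ray_of h i (col i h) by exists 1; rewrite ler01 scale1r.
  rewrite rE => -[/cone_genP[c [c0 _ ic]] ui].
  have [l cl] : exists l, c l != 0.
    apply: contrapT => no; have /eqP := h0 i; apply.
    rewrite ic big1 // => l _; have [->|cl] := eqVneq (c l) 0; first by rewrite scale0r.
    by case: no; exists l.
  have : ray_of h i (v l).
    rewrite rE; split; first by apply: cone_gen_mem; rewrite inE.
    move/eqP: ui; rewrite ic dot_sumr psumr_eq0 => [/allP/(_ l (mem_index_enum l))|j _].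
      by rewrite dotZr mulf_eq0 (negPf cl) => /eqP.
    by rewrite dotZr mulr_ge0 // u0 // inE.
  move=> [a [_ vl]]; exists (l, a^-1); rewrite vl scalerA mulVf ?scale1r //.
  apply/eqP => a0; have v0 : \sum_j (j == l)%:R *: v j = 0.
    rewrite (bigD1 l) //= eqxx scale1r vl a0 scale0r add0r big1 // => j /negPf ->.
    by rewrite scale0r.
  by have /eqP := vfree _ v0 l; rewrite eqxx oner_eq0.
(* The case r = 0 is separated because the default value of [xget] below requires an element of
   'I_r. *)
have [r0|] := posnP r.
  apply/matrixP => i j; rewrite (ord1 j) mxE; have [iA|/gA//] := boolP (i \in A).
  by have [[[l lr] a] _] := ray i iA; move: lr; rewrite r0.
move=> r0; pose f i := xget (Ordinal r0, 0) [set lc : 'I_r * R | col i h = lc.2 *: v lc.1].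
have fP i : i \in A -> col i h = (f i).2 *: v (f i).1.
  by move=> /ray/(xgetPex (Ordinal r0, 0)).
have f0 i : i \in A -> (f i).2 != 0.
  by move=> /fP fi; apply: contra (h0 i) => /eqP fi0; rewrite fi fi0 scale0r.
have finj i j : i \in A -> j \in A -> (f i).1 = (f j).1 -> i = j.
  move=> iA jA fij; apply/eqP/negPn/negP => ij.
  have /eqP := hg i j ij ((f j).2 / (f i).2); apply.
  by rewrite (fP j jA) (fP i iA) fij scalerA divfK // f0.
pose e l := \sum_(i in A | (f i).1 == l) g i 0 * (f i).2.
have e0 l : e l = 0.
  apply: vfree; rewrite -[RHS]hgr mulmx_col [RHS](bigID (mem A)) /=.
  rewrite [X in _ = _ + X]big1 ?addr0; last by move=> i /gA ->; rewrite scale0r.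
  rewrite (partition_big (fun i => (f i).1) predT) //=; apply: eq_bigr => j _.
  rewrite /e scaler_suml; apply: eq_bigr => i /andP[iA /eqP <-].
  by rewrite -scalerA -fP.
apply/matrixP => i j; rewrite (ord1 j) mxE; have [iA|/gA//] := boolP (i \in A).
have := e0 (f i).1; rewrite /e (bigD1 i) /= ?iA ?eqxx // big1 ?addr0.
  by move/eqP; rewrite mulf_eq0 (negPf (f0 i iA)) orbF => /eqP.
by move=> l /andP[/andP[lA /eqP fl] li]; move: li; rewrite (finj l i) // eqxx.
Qed.

(** * Degenerate vertices and the crossing of the wall *)

Section WallCrossing.
Context {R : realType} {n d : nat} (h : 'M[R]_(d, n)).
Implicit Types (a b w g z : 'cV[R]_n) (x y u : 'cV[R]_d) (A B J : {set 'I_n}).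

Local Notation cone J := (cone_gen (fun i => col i h) J).

Lemma touchesZ A b t : 0 <= t -> touches h A b -> touches h A (t *: b).
Proof.
move=> t0 [x [Px /fintype.subsetP Ax]]; exists (t *: x); split=> [i|].
  by rewrite dotZl mxE -mulrN ler_wpM2l.
by apply/fintype.subsetP => i /Ax/activeP xi; apply/activeP; rewrite dotZl mxE xi mulrN.
Qed.

Lemma touchesS A B b : A \subset B -> touches h B b -> touches h A b.
Proof. by move=> AB [x [Px Bx]]; exists x; split=> //; apply: fintype.subset_trans Bx. Qed.

Hypothesis hgeom : geometric_map h.

Lemma affdim_Gamma (k : 'M[R]_(n, n - d)) b : gale_transform h k ->
  full_polytope h b -> tight h b -> simple h b ->
  affdim (Gamma h k (Delta_ h b) (virtual h b)) = (n - d)%N%:Z.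
Proof.
move=> k_gale fb tb sb; have hpos := full_positively_spanning hgeom fb.
apply: (@affdim_open _ _ _ (k^T *m b)) => w.
have [w' ->] := gale_surj k_gale w.
have H := near_simple_Gcone w' sb; near=> e.
rewrite scalemxAr -mulmxDr.
apply/(Gamma_mem hpos k_gale _ hgeom tb (full_nonempty hgeom fb)).
by near: e.
Unshelve. all: by end_near. Qed.

(** For the last clause: a relation g = k t supported on an active set of b0 vanishes on the whole
    cone of b0 by [touches_dot]. That cone has codimension one, so its linear equations form a line
    and t is a multiple of u. *)
Lemma facet_normal (k : 'M[R]_(n, n - d)) b b0 : gale_transform h k ->
  full_polytope h b -> tight h b -> simple h b ->
  full_polytope h b0 -> tight h b0 ->
  facet (Gamma h k (Delta_ h b) (virtual h b)) (Gamma h k (Delta_ h b0) (virtual h b0)) ->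
  exists u : 'cV[R]_(n - d), let z := k *m u in [/\ z != 0,
    forall a, Gcone h b a -> 0 <= dot z a,
    forall a, Gcone h b0 a <-> Gcone h b a /\ dot z a = 0 &
    forall x g, vertex h b0 x -> h *m g = 0 ->
      (forall i, i \notin active h b0 x -> g i 0 = 0) -> exists c, g = c *: z].
Proof.
move=> k_gale fb tb sb fb0 tb0 [[_ [u [c [uc GE]]]] dimG].
have hpos := full_positively_spanning hgeom fb.
have Gmem a := Gamma_mem hpos k_gale a hgeom tb (full_nonempty hgeom fb).
have Gmem0 a := Gamma_mem hpos k_gale a hgeom tb0 (full_nonempty hgeom fb0).
have dotu a : dot (k *m u) a = dot u (k^T *m a) by rewrite dot_mulmxl.
(* The cone contains 2 b0 and 0 along with b0, which forces the constant of the supporting form to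
   vanish. *)
have c0 : c = 0.
  have : Gamma h k (Delta_ h b0) (virtual h b0) (k^T *m b0).
    by apply/Gmem0; apply: Gcone_refl.
  rewrite GE => -[/Gmem Gb0 ub0].
  have := uc _ ((Gmem (2 *: b0)).2 (fun x vx => touchesZ (ler0n _ 2) (Gb0 x vx))).
  have := uc _ ((Gmem (0 *: b0)).2 (fun x vx => touchesZ (lexx 0) (Gb0 x vx))).
  rewrite -!scalemxAr !dotZr ub0; lra.
rewrite {c}c0 in uc GE.
have G0E a : Gcone h b0 a <-> Gcone h b a /\ dot (k *m u) a = 0.
  rewrite dotu; split=> [/Gmem0|[/Gmem Ga ua]]; first by rewrite GE => -[/Gmem].
  by apply/Gmem0; rewrite GE.
have u0 : u != 0.
  apply/eqP => u0; move: dimG; rewrite GE u0; set C := Gamma _ _ _ _.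
  rewrite (_ : [set _ | _] = C); first by lia.
  by apply/seteqP; split=> v; [case|move=> Cv; split=> //; rewrite dot0l].
have [kinj kker] := k_gale.
have z0 : k *m u != 0.
  by apply: contra u0 => /eqP ku; apply/eqP/kinj; rewrite /= ku mulmx0.
have dimb := affdim_Gamma k_gale fb tb sb.
exists u; split=> // [a /Gmem/uc|x g vx hg gx]; first by rewrite dotu.
have [t gt] := (kker g).1 hg.
suff [e te] : exists e, t = e *: u by exists e; rewrite gt te scalemxAr.
apply: (@affdim_hyperplane_line _ _ (Gamma h k (Delta_ h b0) (virtual h b0)) u t 0 0) => //.
- by rewrite dimG dimb.
- by move=> v; rewrite GE dotC => -[].
- move=> _ [a la <-]; rewrite dotC -dot_mulmxl -gt; apply: (touches_dot hg gx).
  have /Gmem0 : Gamma h k (Delta_ h b0) (virtual h b0) (k^T *m a) by exists a.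
  exact.
Qed.

Variables (b b0 z : 'cV[R]_n).
Hypotheses (fb : full_polytope h b) (tb : tight h b) (sb : simple h b).
Hypotheses (fb0 : full_polytope h b0) (tb0 : tight h b0).
Hypotheses (hz : h *m z = 0) (z0 : z != 0).
Hypothesis z_ge0 : forall a, Gcone h b a -> 0 <= dot z a.
Hypothesis wallE : forall a, Gcone h b0 a <-> Gcone h b a /\ dot z a = 0.
Hypothesis z_line : forall x g, vertex h b0 x -> h *m g = 0 ->
  (forall i, i \notin active h b0 x -> g i 0 = 0) -> exists c, g = c *: z.

Let hpos := full_positively_spanning hgeom fb.

Definition degenerate x : Prop :=
  vertex h b0 x /\ forall i, i \notin active h b0 x -> z i 0 = 0.

Lemma vertex_cases x : vertex h b0 x ->
  independent h (active h b0 x) \/ degenerate x.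
Proof.
move=> vx; have [|nd] := pselect (degenerate x); [by right|left => g hg gx].
have [c gc] := z_line vx hg gx; have [c0|c0] := eqVneq c 0; first by rewrite gc c0 scale0r.
case: nd; split=> // i ix; have := gx i ix; rewrite gc mxE => /eqP.
by rewrite mulf_eq0 (negPf c0) => /eqP.
Qed.

(** Otherwise b0 would be simple and remain in its own cone when moved along z, although that cone
    lies in the hyperplane <z, a> = 0. *)
Lemma degenerate_exists : exists x, degenerate x.
Proof.
apply: contrapT => no; have sb0 : simple h b0.
  by move=> x vx; have [//|dx] := vertex_cases vx; case: no; exists x.
have [e e0 /wallE[_]] := near_witness (near_simple_Gcone z sb0).
have [_ zb0] := (wallE b0).1 (@Gcone_refl _ _ _ h b0).
rewrite dotDr dotZr zb0 add0r => /eqP.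
by rewrite mulf_eq0 gt_eqF //= dot_eq0 (negPf z0).
Qed.

Lemma wall_dot0 : dot z b0 = 0.
Proof. by have [] := (wallE b0).1 (@Gcone_refl _ _ _ h b0). Qed.

(** At an interior point of P_b0 all slacks are positive, yet their combination with coefficients
    z_i is <z, b0> = 0. *)
Lemma exists_neg : exists j, z j 0 < 0.
Proof.
apply: contrapT => no; have zge i : 0 <= z i 0.
  by rewrite leNgt; apply/negP => zi; apply: no; exists i.
have [_ [x xb0]] := (full_polytopeP _ hgeom).1 fb0.
have slack i : 0 < b0 i 0 + dot x (col i h) by rewrite -ltrBlDl sub0r.
move/eqP: wall_dot0; rewrite (relation_slack b0 x hz) psumr_eq0; last first.
  by move=> i _; rewrite mulr_ge0 // ltW.
move=> /allP zx; move/eqP: z0; apply; apply/matrixP => i j; rewrite (ord1 j) mxE.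
by have := zx i (mem_index_enum i); rewrite mulf_eq0 (gt_eqF (slack i)) orbF => /eqP.
Qed.

Lemma supp_active x j : degenerate x -> z j 0 != 0 -> j \in active h b0 x.
Proof. by move=> [_ zx]; apply: contra_neqT => /zx. Qed.

(** The relation z expresses h(e_j) through the other active normals. With [independentD1], deleting
    any index of the support of z from A leaves a basis. *)
Lemma spanningD1 x j : degenerate x -> z j 0 != 0 ->
  spanning h (active h b0 x :\ j)%SET.
Proof.
move=> [[Px sx] zx] zj y yA; apply: sx => i ix; have [->|ij] := eqVneq i j; last first.
  by apply: yA; rewrite !inE ij; move: ix; rewrite inE.
have := dot_relation y hz; rewrite (bigD1 j) //= big1 ?addr0 => [/eqP|l lj].
  by rewrite mulf_eq0 (negPf zj) => /eqP.
have [lx|/zx ->] := boolP (l \in active h b0 x); last by rewrite mul0r.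
by rewrite yA ?mulr0 // !inE lj; move: lx; rewrite inE.
Qed.

Lemma independentD1 x j : degenerate x -> z j 0 != 0 ->
  independent h (active h b0 x :\ j)%SET.
Proof.
move=> [vx zx] zj g hg gA; have [c gc] : exists c, g = c *: z.
  apply: z_line vx hg _ => i ix; apply: gA; apply: contra ix.
  by rewrite finset.in_setD1 => /andP[].
have := gA j; rewrite finset.setD11 => /(_ erefl)/eqP; rewrite gc mxE.
by rewrite mulf_eq0 (negPf zj) orbF => /eqP ->; rewrite scale0r.
Qed.

(** In [relation_slack] only the term of j survives, so the sign of z_j tells on which side of the
    wall a lies. *)
Lemma slackD1 x j a p : degenerate x -> z j 0 != 0 -> P_ h a p ->
  (active h b0 x :\ j)%SET \subset active h a p ->
  dot z a = z j 0 * (a j 0 + dot p (col j h)).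
Proof.
move=> [vx zx] zj Pp /fintype.subsetP xp; rewrite (relation_slack a p hz).
rewrite (bigD1 j) //= big1 ?addr0 // => i ij.
have [ix|/zx ->] := boolP (i \in active h b0 x); last by rewrite mul0r.
have /xp/activeP -> : i \in (active h b0 x :\ j)%SET by rewrite finset.in_setD1 ij.
by rewrite subrr mulr0.
Qed.

(* The slack created at j has the sign of [- z j] because
   [z j * (<y, v_j> - z j) = - <z, z>] for the solution y below. *)
Lemma near_flip x j : degenerate x -> z j 0 < 0 ->
  \forall e \near 0^'+, exists x', P_ h (b0 + e *: (- z)) x' /\
    active h (b0 + e *: (- z)) x' = (active h b0 x :\ j)%SET.
Proof.
move=> dx zj; have zj0 : z j 0 != 0 by rewrite lt_eqF.
have jx := supp_active dx zj0.
have [y yz] := independent_solve z (independentD1 dx zj0).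
have yj : 0 < dot y (col j h) - z j 0.
  have := dot_relation y hz; rewrite (bigD1 j) //=.
  rewrite (eq_bigr (fun i => z i 0 * z i 0)) => [|i ij]; last first.
    have [ix|/dx.2 ->] := boolP (i \in active h b0 x); last by rewrite !mul0r.
    by rewrite yz // finset.in_setD1 ij.
  have := dot_gt0 z0; rewrite dotE (bigD1 j) //=.
  by nra.
have H : \forall e \near 0^'+, forall i, i \notin active h b0 x ->
    - (b0 + e *: (- z)) i 0 < dot (x + e *: y) (col i h).
  apply: near_forall_fin => i; have [ia|ia] := boolP (i \in active h b0 x).
    by near=> e.
  by have := near_slack (- z) y (active_lt dx.1.1 ia) => H; near=> e => _; near: e.
have Hpos : \forall e \near (0 : R)^'+, 0 < e by apply: nbhs_right_gt.
near=> e; have He : forall i, i \notin active h b0 x ->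
    - (b0 + e *: (- z)) i 0 < dot (x + e *: y) (col i h) by near: e.
have e0 : 0 < e by near: e.
have xi i : i \in (active h b0 x :\ j)%SET ->
    dot (x + e *: y) (col i h) = - (b0 + e *: (- z)) i 0.
  move=> ix; have := yz i ix; move: ix; rewrite finset.in_setD1 => /andP[_ /activeP ix] iz.
  by rewrite dotDl dotZl ix iz !mxE; ring.
have xj : - (b0 + e *: (- z)) j 0 < dot (x + e *: y) (col j h).
  by have /activeP := jx; rewrite dotDl dotZl !mxE => ->; nra.
have strict i : i \notin (active h b0 x :\ j)%SET ->
    - (b0 + e *: (- z)) i 0 < dot (x + e *: y) (col i h).
  by have [->//|ij] := eqVneq i j; rewrite finset.in_setD1 ij => /He.
exists (x + e *: y); split=> [i|].
  by have [/xi ->|/strict/ltW] := boolP (i \in (active h b0 x :\ j)%SET).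
apply/finset.setP => i; apply/activeP/idP => [ie|]; last exact: xi.
by apply/negPn/negP => /strict; rewrite ie ltxx.
Unshelve. all: by end_near. Qed.

(* Satisfied by [b' = b0 - e *: z] for small [e > 0]. *)
Definition crosses b' : Prop :=
  [/\ full_polytope h b', dot z b' < 0,
      forall x', vertex h b' x' ->
        exists2 x, vertex h b0 x & active h b' x' \subset active h b0 x,
      forall x, P_ h b0 x -> independent h (active h b0 x) ->
        exists x', P_ h b' x' /\ active h b' x' = active h b0 x &
      forall x j, degenerate x -> z j 0 < 0 ->
        exists x', P_ h b' x' /\ active h b' x' = (active h b0 x :\ j)%SET].

Lemma crosses_exists : exists b', crosses b'.
Proof.
have H1 := near_full hgeom (- z) fb0; have H2 := near_vertex h b0 (- z).
have H3 : \forall e \near 0^'+, forall A,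
    (exists x, [/\ P_ h b0 x, active h b0 x = A & independent h A]) ->
    exists x', P_ h (b0 + e *: (- z)) x' /\ active h (b0 + e *: (- z)) x' = A.
  apply: near_forall_fin => A.
  have [[x [Px xA iA]]|no] := pselect
    (exists x, [/\ P_ h b0 x, active h b0 x = A & independent h A]); last by near=> e.
  rewrite -xA in iA; have H := near_touches_independent (- z) Px iA.
  by near=> e => _; rewrite -xA; near: e.
have H4 : \forall e \near 0^'+, forall Aj : {set 'I_n} * 'I_n,
    (exists x, [/\ degenerate x, active h b0 x = Aj.1 & z Aj.2 0 < 0]) ->
    exists x', P_ h (b0 + e *: (- z)) x' /\
      active h (b0 + e *: (- z)) x' = (Aj.1 :\ Aj.2)%SET.
  apply: near_forall_fin => -[A j] /=.
  have [[x [dx xA zj]]|no] := pselect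
    (exists x, [/\ degenerate x, active h b0 x = A & z j 0 < 0]); last by near=> e.
  have H := near_flip dx zj; near=> e => _; rewrite -xA; by near: e.
have [e e0 [[He1 He2] [He3 He4]]] := near_witness (filterI (filterI H1 H2) (filterI H3 H4)).
exists (b0 + e *: (- z)); split=> //.
- by rewrite dotDr wall_dot0 add0r dotZr dotNr mulrN oppr_lt0 mulr_gt0 // dot_gt0.
- by move=> x Px ix; apply: He3; exists x.
- by move=> x j dx zj; apply: (He4 (active h b0 x, j)); exists x.
Unshelve. all: by end_near. Qed.

Variable b' : 'cV[R]_n.
Hypothesis xb' : crosses b'.

Lemma crosses_touch i x : P_ h b' x -> i \in active h b' x -> i \notin virtual h b0.
Proof.
have [_ _ near_vx _ _] := xb'; move=> Px ix.
have [x' [vx' xx' _]] := push hpos 0 Px; have [x0 [Px0 _] x'x0] := near_vx _ vx'.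
apply/negP => /(tb0 Px0)/negP[]; apply: (fintype.subsetP x'x0).
exact: (fintype.subsetP xx').
Qed.

(** A single nonzero normal is independent, so a point of P_b0 where i alone is tight persists in
    P_b'. Conversely a facet of P_b' touches it at a vertex specializing to one of P_b0, where no
    virtual index is tight. *)
Lemma crosses_virtual : virtual h b' = virtual h b0.
Proof.
have [_ _ _ keep _] := xb'; apply/finset.setP => i; apply/idP/idP; apply: contraLR.
  move=> /(virtualPn _ _ hgeom)[x [Px xi]]; apply/(virtualPn _ _ hgeom).
  rewrite -xi; apply: keep => //; rewrite xi => g hg gi.
  apply/matrixP => l m; rewrite (ord1 m) mxE; have [->|li] := eqVneq l i; last first.
    by apply: gi; rewrite finset.in_set1.
  move/eqP: hg; rewrite mulmx_col (bigD1 i) //= big1 ?addr0 => [|j ji].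
    by rewrite scaler_eq0; have [/(_ i)/negPf -> _] := hgeom; rewrite orbF => /eqP.
  by rewrite gi ?scale0r // finset.in_set1.
move=> /(virtualPn _ _ hgeom)[x [Px xi]]; apply: (crosses_touch Px).
by rewrite xi finset.in_set1.
Qed.

Lemma crosses_tight : tight h b'.
Proof.
by move=> x i Px; rewrite crosses_virtual; apply: contraTN => /(crosses_touch Px).
Qed.

(** A relation on an active set of b' is a multiple of z and must vanish on b', but <z, b'> < 0. *)
Lemma crosses_simple : simple h b'.
Proof.
have [_ zb' near_vx _ _] := xb'; move=> x vx g hg gx; have [x0 vx0 xx0] := near_vx x vx.
have [c gc] : exists c, g = c *: z.
  by apply: z_line vx0 hg _ => i ix; apply: gx; apply: contra ix; apply: (fintype.subsetP xx0).
have /eqP := touches_dot hg gx (@Gcone_refl _ _ _ h b' _ vx).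
by rewrite gc dotZl mulf_eq0 (lt_eqF zb') orbF => /eqP ->; rewrite scale0r.
Qed.

Lemma crosses_vertexD1 x j : degenerate x -> z j 0 < 0 ->
  exists2 x', vertex h b' x' & active h b' x' = (active h b0 x :\ j)%SET.
Proof.
have [_ _ _ _ flip] := xb'; move=> dx zj; have [x' [Px' xx']] := flip x j dx zj.
by exists x' => //; split=> //; rewrite xx'; apply: spanningD1; rewrite // lt_eqF.
Qed.

(** At the new vertex with active set A \ j, <z, a> is z_j < 0 times a nonnegative slack. *)
Lemma crosses_le0 a : Gcone h b' a -> dot z a <= 0.
Proof.
have [x dx] := degenerate_exists; have [j zj] := exists_neg.
have [x' vx' xx'] := crosses_vertexD1 dx zj => /(_ _ vx')[p [Pp]]; rewrite xx' => xp.
rewrite (slackD1 dx _ Pp xp) ?lt_eqF //; apply: mulr_le0_ge0; first exact: ltW.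
by rewrite -lerBlDl sub0r; apply: Pp.
Qed.

(** For the converse, a point touching A \ j has slack zero at j as soon as <z, a> = 0, hence
    touches all of A. *)
Lemma crosses_wallE a : Gcone h b0 a <-> Gcone h b' a /\ dot z a = 0.
Proof.
have [_ _ near_vx keep _] := xb'; split=> [Ga|[Ga za] x vx].
  split; last by have [] := (wallE a).1 Ga.
  by move=> x /near_vx[x0 vx0 xx0]; apply: touchesS xx0 (Ga _ vx0).
have [ix|dx] := vertex_cases vx.
  have [x' [Px' xx']] := keep x vx.1 ix; rewrite -xx'; apply: Ga.
  by split=> //; rewrite xx'; case: vx.
have [j zj] := exists_neg; have zj0 : z j 0 != 0 by rewrite lt_eqF.
have [x' vx' xx'] := crosses_vertexD1 dx zj.
have [p [Pp]] := Ga _ vx'; rewrite xx' => xp; exists p; split=> //.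
move/eqP: za; rewrite (slackD1 dx _ Pp xp) // mulf_eq0 (negPf zj0) /= addrC addr_eq0 => /eqP pj.
apply/fintype.subsetP => i ix; have [->|ij] := eqVneq i j; first exact/activeP.
by apply: (fintype.subsetP xp); rewrite finset.in_setD1 ij.
Qed.

(* [x1] is the vertex of P_b minimizing the sum of the active normals of x. *)
Lemma degenerate_resolution x : degenerate x -> exists i x1,
  [/\ 0 < z i 0, vertex h b x1 & active h b x1 = (active h b0 x :\ i)%SET].
Proof.
move=> dx; have [vx zx] := dx; set A := active h b0 x.
have [x1 [vx1 x1A]] := lp_duality hpos (\sum_(i in A) col i h) (full_nonempty hgeom fb).
have [Gb0 _] := (wallE b0).1 (@Gcone_refl _ _ _ h b0).
have x1x : active h b x1 \subset A.
  have [p [Pp x1p]] := Gb0 _ vx1; suff px : p = x by rewrite /A -px.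
  by apply: vertex_minimizer vx Pp _; apply: cone_genS x1A.
(* Expressing a missing normal through those active at x1 gives a relation on A, a multiple of z. So
   z is nonzero at i and zero at every other missing index, and at most one index of A is
   missing. *)
have extra i : i \in A -> i \notin active h b x1 ->
    z i 0 != 0 /\ forall j, j \notin active h b x1 -> j != i -> z j 0 = 0.
  move=> iA ix1; have [g [hg gi gx1 _]] := spanning_extra vx1.2 x1x iA ix1.
  have [c gc] : exists c, g = c *: z.
    apply: z_line vx hg _ => j jA; apply: gx1.
      by apply: contra jA; apply: (fintype.subsetP x1x).
    by apply: contra jA => /eqP ->.
  have c0 : c != 0.
    by apply/eqP => c0; move/eqP: gi; rewrite gc c0 scale0r mxE eq_sym oner_eq0.
  split=> [|j jx1 ji].
    by apply/eqP => zi; move/eqP: gi; rewrite gc mxE zi mulr0 eq_sym oner_eq0.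
  by have /eqP := gx1 j jx1 ji; rewrite gc mxE mulf_eq0 (negPf c0) => /eqP.
have [i iA ix1] : exists2 i, i \in A & i \notin active h b x1.
  apply: contrapT => no; have /eqP := z0; apply; apply: (sb vx1) => // i ix1.
  by apply: zx; apply/negP => iA; apply: no; exists i.
have [zi zj] := extra i iA ix1.
have x1E : active h b x1 = (A :\ i)%SET.
  apply/finset.setP => j; rewrite finset.in_setD1.
  have [->|ji /=] := eqVneq j i; first by rewrite (negPf ix1).
  apply/idP/idP => [/(fintype.subsetP x1x)//|jA]; apply/negPn/negP => jx1.
  by have [] := extra j jA jx1; rewrite zj ?eqxx.
exists i, x1; split=> //.
(* As b is interior to its cone, b - e z still lies in it, so <z, b> >= e <z, z> > 0; by [slackD1]
   this decides the sign of z_i. *)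
have zb : 0 < dot z b.
  have [e e0 /z_ge0] := near_witness (near_simple_Gcone (- z) sb).
  have := mulr_gt0 e0 (dot_gt0 z0); rewrite dotDr dotZr dotNr; lra.
move: zb; rewrite (slackD1 dx zi vx1.1); last by rewrite x1E.
rewrite pmulr_lgt0 // -ltrBlDl sub0r; apply: active_lt ix1; case: vx1 => //.
Qed.

(** Positive coefficients on a spanning set make the point interior to t. The form exposing the face
    [s & t] of t vanishes there, hence on all of B, so it is zero and the face is t itself. *)
Lemma fan_cone_sub (D : set (set 'cV[R]_d)) s t B (c : 'I_n -> R) : fan D ->
  D s -> D t -> cone B `<=` t -> spanning h B ->
  (forall i, i \in B -> 0 < c i) -> s (\sum_(i in B) c i *: col i h) -> t `<=` s.
Proof.
move=> [_ Dcone _ Dcap] Ds Dt Bt sB c0 sp.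
have tp : t (\sum_(i in B) c i *: col i h).
  apply: Bt; apply/cone_genP; exists (fun i => if i \in B then c i else 0).
  split=> [i|i /negPf ->//|].
    by case: ifP => // /c0/ltW.
  by rewrite [LHS]big_mkcond; apply: eq_bigr => i _; case: ifP => //; rewrite scale0r.
have [[r [v tE]] _] := Dcone _ Dt; have [_] := Dcap _ _ Ds Dt.
rewrite {1}tE => /face_coneE[u u0 stE].
have ut y : t y -> 0 <= dot u y.
  rewrite tE => -[e [e0 ->]]; rewrite dot_sumr; apply: sumr_ge0 => i iT.
  by rewrite dotZr mulr_ge0 // u0.
have : (s `&` t) (\sum_(i in B) c i *: col i h) by [].
rewrite stE => -[_ /eqP]; rewrite dot_sumr psumr_eq0 => [/allP uB|i iB]; last first.
  by rewrite dotZr mulr_ge0 ?(ltW (c0 i iB)) //; apply/ut/Bt/cone_gen_mem.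
have u00 : u = 0.
  apply: sB => i iB; have := uB i (mem_index_enum i).
  by rewrite iB dotZr mulf_eq0 (gt_eqF (c0 i iB)) => /eqP.
move=> y ty; suff [] : (s `&` t) y by [].
by rewrite stE -tE; split=> //; rewrite u00 dot0l.
Qed.

(** Adding a multiple of the relation z does not change q; the multiple is increased until the first
    coefficient with z_j < 0 reaches zero. This is one of the two triangulations of a circuit. *)
Lemma cone_cover x q : degenerate x -> cone (active h b0 x) q ->
  exists j, z j 0 < 0 /\ cone (active h b0 x :\ j)%SET q.
Proof.
move=> dx /cone_genP[c [c0 cA ->]]; have [j0 zj0] := exists_neg.
have [j zj jmin] := @arg_minP _ _ _ j0 (fun j => z j 0 < 0) (fun j => c j / - z j 0) zj0.
exists j; split=> //; apply/cone_genP.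
have t0 : 0 <= c j / - z j 0 by rewrite divr_ge0 // oppr_ge0 ltW.
exists (fun i => c i + c j / - z j 0 * z i 0); split=> [i|i|].
- have [zi|zi] := leP 0 (z i 0); first by rewrite addr_ge0 // mulr_ge0.
  by have := jmin i zi; rewrite ler_pdivlMr ?oppr_gt0 //; lra.
- rewrite finset.in_setD1 negb_and negbK => /orP[/eqP ->|ix].
    by rewrite invrN mulrN mulNr divfK ?subrr // lt_eqF.
  by rewrite (cA i ix) (dx.2 i ix) mulr0 addr0.
- under [RHS]eq_bigr do rewrite scalerDl -scalerA.
  by rewrite big_split /= -scaler_sumr -mulmx_col hz scaler0 addr0.
Qed.

Lemma crosses_coarsening : coarsening (Delta_ h b0) (Delta_ h b').
Proof.
have [fb' _ near_vx _ _] := xb'; have tb' := crosses_tight.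
split; first by rewrite !support_Delta //; apply: full_nonempty.
move=> s /(Delta_inv hpos tb')[x [J [vx Jx ->]]]; have [x0 [Px0 _] xx0] := near_vx _ vx.
exists (cone (active h b0 x0)); split; first exact: Delta_active.
by apply: cone_genS; apply: fintype.subset_trans xx0.
Qed.

Lemma wall_coarsening : coarsening (Delta_ h b0) (Delta_ h b).
Proof.
split; first by rewrite !support_Delta //; apply: full_nonempty.
move=> s /(Delta_inv hpos tb)[x [J [vx Jx ->]]].
have [Gb0 _] := (wallE b0).1 (@Gcone_refl _ _ _ h b0); have [p [Pp xp]] := Gb0 _ vx.
exists (cone (active h b0 p)); split; first exact: Delta_active.
by apply: cone_genS; apply: fintype.subset_trans xp.
Qed.

(* If z_i > 0 > z_j, the interiors of the cones on A \ i and A \ j meet: both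
   [G - z] and [G + z] below are coefficients of the same point. *)
Lemma finest_coarsening D : fan D -> coarsening D (Delta_ h b) ->
  coarsening D (Delta_ h b') -> coarsening D (Delta_ h b0).
Proof.
have [_ _ _ keep _] := xb'; have tb' := crosses_tight.
move=> fD [suppD Db] [_ Db']; split.
  by rewrite suppD !support_Delta //; apply: full_nonempty.
move=> s /(Delta_inv hpos tb0)[x [J [vx Jx ->]]].
suff [t [Dt At]] : exists t, D t /\ cone (active h b0 x) `<=` t.
  by exists t; split=> //; apply: subset_trans At; apply: cone_genS.
have [ix|dx] := vertex_cases vx.
  have [x' [Px' <-]] := keep x vx.1 ix; apply: Db'; exact: Delta_active.
have [i [x1 [zi vx1 x1E]]] := degenerate_resolution dx.
have [t [Dt it]] := Db _ (Delta_active tb vx1.1); rewrite x1E in it.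
exists t; split=> // q /(cone_cover dx)[j [zj jq]].
have [x' vx' x'E] := crosses_vertexD1 dx zj.
have [t' [Dt' jt']] := Db' _ (Delta_active tb' vx'.1); rewrite x'E in jt'.
suff : t' `<=` t by apply; apply: jt'.
(* G equals |z| at i and j and exceeds it elsewhere on A: G - z is nonnegative and vanishes at i,
   while G + z vanishes at j and is positive on the rest of A. *)
pose G l := if (l == i) || (l == j) then `|z l 0| else (l \in active h b0 x)%:R * (1 + `|z l 0|).
have Gout l : l \notin active h b0 x -> G l = 0.
  move=> lx; rewrite /G (negPf lx) mul0r dx.2 // normr0; by case: ifP.
have Gz l : l \in active h b0 x -> `|z l 0| <= G l /\ (l != i -> l != j -> `|z l 0| < G l).
  move=> lx; rewrite /G lx mul1r; case: eqP => [->|_]; first by [].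
  by case: eqP => [->|_] //=; split=> [|_ _]; rewrite ?lerDr ?ltrDr.
have zle l : - `|z l 0| <= z l 0 <= `|z l 0| by rewrite -ler_norml.
apply: (fan_cone_sub fD Dt Dt' jt' (spanningD1 dx _) (c := fun l => G l + z l 0)).
- by rewrite lt_eqF.
- move=> l; rewrite finset.in_setD1 => /andP[lj /Gz[_ Gl]].
  have [->|li] := eqVneq l i; first by rewrite /G eqxx /= gtr0_norm //; lra.
  by have := Gl li lj; have /andP[] := zle l; lra.
apply: it; apply/cone_genP; exists (fun l => G l - z l 0); split=> [l|l|].
- have [/Gz[Gl _]|lx] := boolP (l \in active h b0 x); last by rewrite Gout // dx.2 // subrr.
  by have /andP[] := zle l; lra.
- rewrite finset.in_setD1 negb_and negbK => /orP[/eqP ->|lx].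
    by rewrite /G eqxx gtr0_norm // subrr.
  by rewrite Gout // dx.2 // subrr.
transitivity (\sum_l (G l + z l 0) *: col l h).
  rewrite big_mkcond; apply: eq_bigr => l _; rewrite finset.in_setD1.
  have [->|lj] := eqVneq l j; first by rewrite /G eqxx orbT ltr0_norm // addNr scale0r.
  by case: ifPn => //= lx; rewrite Gout // dx.2 // addr0 scale0r.
under eq_bigr do rewrite scalerDl; under [RHS]eq_bigr do rewrite scalerBl.
by rewrite big_split sumrB /= -!mulmx_col hz addr0 subr0.
Qed.

Lemma wall_not_simplicial : quantum_fan h (Delta_ h b0) (virtual h b0) ->
  ~ simplicial_fan (Delta_ h b0).
Proof.
move=> [fD rD] simp; have [x dx] := degenerate_exists; have Px := dx.1.1.
have /eqP := z0; apply; apply: (@simplicial_independent _ _ _ h _ _ hgeom fD (Delta_active tb0 Px)).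
- move=> i ix; suff [] : rays (Delta_ h b0) (ray_of h i) by [].
  rewrite rD; exists i => //; apply/negP => /(tb0 Px); by rewrite ix.
- exact/simp/Delta_active.
- exact: hz.
- exact: dx.2.
Qed.

End WallCrossing.

(** * Zariski closures of cylinders over irreducible sets *)

Section ZariskiClosure.
Context {K : numFieldType} {n : nat}.
Implicit Types (z y : 'cV[K]_n) (Y Z W X : set 'cV[K]_n) (p q : mpoly.mpoly n K).

Definition evalp z p : K := mpoly.meval (fun i => z i 0) p.

(** Restriction of p to the line through z in direction e_i, a univariate polynomial in the
    parameter. *)
Definition linep z i p : {poly K} :=
  mpoly.mmap (@polyC K) (fun l => (z l 0)%:P + (l == i)%:R *: 'X) p.

Lemma linepE z i p t : (linep z i p).[t] = evalp (z + t *: delta_mx i 0) p.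
Proof.
rewrite /linep /mpoly.mmap /evalp mpoly.mevalE horner_sum; apply: eq_bigr => m _.
rewrite hornerM hornerC /mpoly.mmap1 horner_prod; congr (_ * _).
apply: eq_bigr => l _; rewrite horner_exp hornerD hornerC hornerZ hornerX !mxE.
by rewrite andbT mulrC.
Qed.

Definition shiftp i t p : mpoly.mpoly n K :=
  mpoly.comp_mpoly [tuple mpoly.mpolyX K (mpoly.mnm1 l) +
    mpoly.mpolyC n (t * (l == i)%:R) | l < n] p.

Lemma shiftpE z i t p : evalp z (shiftp i t p) = evalp (z + t *: delta_mx i 0) p.
Proof.
rewrite /evalp mpoly.comp_mpoly_meval; apply: mpoly.meval_eq => l.
by rewrite tnth_mktuple mpoly.mevalD mpoly.mevalXU mpoly.mevalC !mxE andbT.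
Qed.

(** In characteristic zero the naturals below [size p] are distinct, too many to be all roots. *)
Lemma nonroot (p : {poly K}) : p != 0 -> exists t, p.[t] != 0.
Proof.
move=> p0; apply: contrapT => no.
pose rs := [seq k%:R : K | k <- iota 0 (size p)].
have := @max_poly_roots _ p rs p0; rewrite size_map size_iota ltnn => H.
suff : false by []; apply: H.
  apply/allP => t _; apply/negPn/negP => pt; apply: no; exists t.
  exact: pt.
rewrite map_inj_uniq ?iota_uniq // => k l /eqP; rewrite eqr_nat => /eqP //.
Qed.

Variable X : set 'cV[K]_n.

Lemma closed_setU Z W : zariski_closed X Z -> zariski_closed X W ->
  zariski_closed X (Z `|` W).
Proof.
move=> [S ->] [T ->]; exists [set r | exists p q, [/\ S p, T q & r = p * q]].
apply/seteqP; split=> z.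
  case=> -[Xz zS]; split=> // _ [p [q [Sp Tq ->]]]; rewrite mpoly.mevalM.
    by rewrite (zS p Sp) mul0r.
  by rewrite (zS q Tq) mulr0.
move=> [Xz zST]; have [zS|nzS] := pselect (forall p, S p -> evalp z p = 0); first by left.
right; split=> // q Tq; apply/eqP/negPn/negP => zq; apply: nzS => p Sp.
have /eqP := zST _ (ex_intro _ p (ex_intro _ q (And3 Sp Tq erefl))).
by rewrite mpoly.mevalM mulf_eq0 (negPf zq) orbF => /eqP.
Qed.

Lemma closed_coord (J : set 'I_n) :
  zariski_closed X (X `&` [set z | forall i, J i -> z i 0 = 0]).
Proof.
exists [set mpoly.mpolyX K (mpoly.mnm1 i) | i in J]; congr (_ `&` _).
apply/seteqP; split=> z zJ; first by move=> _ [i Ji <-]; rewrite mpoly.mevalXU zJ.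
by move=> i Ji; rewrite -(mpoly.mevalXU (fun i => z i 0)); apply: zJ; exists i.
Qed.

Definition zclosure W : set 'cV[K]_n :=
  X `&` [set z | forall p, (forall w, W w -> evalp w p = 0) -> evalp z p = 0].

Lemma zclosure_closed W : zariski_closed X (zclosure W).
Proof. by exists [set p | forall w, W w -> evalp w p = 0]. Qed.

Lemma zclosure_sub W : W `<=` X -> W `<=` zclosure W.
Proof. by move=> WX w Ww; split=> [|p]; [exact: WX|apply]. Qed.

Lemma zclosure_min W Z : zariski_closed X Z -> W `<=` Z -> zclosure W `<=` Z.
Proof.
move=> [S ->] WZ z [Xz zW]; split=> // p Sp; apply: zW => w /WZ[_]; exact.
Qed.

Definition cylinder Y i : set 'cV[K]_n :=
  [set z | exists y t, Y y /\ z = y + t *: delta_mx i 0].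

(** Satisfied by [S_ h I D], which is cut out by nonvanishing conditions only; see [S_free]. *)
Hypothesis X_free : forall z i t, X z -> z i 0 = 0 -> X (z + t *: delta_mx i 0).

Variables (Y : set 'cV[K]_n) (i : 'I_n).
Hypotheses (Yirr : irreducible_closed X Y) (Yi : forall y, Y y -> y i 0 = 0).

Let YX : Y `<=` X. Proof. by have [[S ->] _ _] := Yirr => y []. Qed.

Lemma cylinder_sub : cylinder Y i `<=` X.
Proof. by move=> _ [y [t [Yy ->]]]; apply: X_free; [apply: YX|apply: Yi]. Qed.

Lemma sub_cylinder : Y `<=` cylinder Y i.
Proof. by move=> y Yy; exists y, 0; rewrite scale0r addr0. Qed.

(* If neither Z1 nor Z2 contains the cylinder, restricting a defining polynomial
   of each to a line in the direction e_i gives a parameter t at which the slice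
   Y + t e_i, irreducible as Y is, is contained in neither. *)
Lemma irreducible_cylinder : irreducible_closed X (zclosure (cylinder Y i)).
Proof.
have [_ [y0 Yy0] Yirr'] := Yirr; split.
- exact: zclosure_closed.
- by exists y0; apply: zclosure_sub cylinder_sub _ _; apply: sub_cylinder.
move=> Z1 Z2 clZ1 clZ2 sub12.
have {sub12} sub12 : cylinder Y i `<=` Z1 `|` Z2.
  by apply: subset_trans sub12; apply: zclosure_sub cylinder_sub.
suff [c1|c2] : cylinder Y i `<=` Z1 \/ cylinder Y i `<=` Z2.
- by left; apply: zclosure_min.
- by right; apply: zclosure_min.
have bad Z (S : set (mpoly.mpoly n K)) : Z = X `&` [set z | forall p, S p -> evalp z p = 0] ->
    ~ cylinder Y i `<=` Z -> exists y p, [/\ Y y, S p & linep y i p != 0].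
  move=> ZE nsub; apply: contrapT => no; apply: nsub => _ [y [t [Yy ->]]].
  rewrite ZE; split=> [|p Sp]; first by apply: cylinder_sub; exists y, t.
  rewrite -linepE; suff -> : linep y i p = 0 by rewrite horner0.
  by apply/eqP/negPn/negP => yp; apply: no; exists y, p.
have slice (S : set (mpoly.mpoly n K)) t : zariski_closed X
    (X `&` [set z | forall p, S p -> evalp (z + t *: delta_mx i 0) p = 0]).
  exists [set shiftp i t p | p in S]; congr (_ `&` _); apply/seteqP; split=> z zS.
    by move=> _ [p Sp <-]; rewrite -[LHS]/(evalp _ _) shiftpE zS.
  by move=> p Sp; rewrite -shiftpE; apply: zS; exists p.
have [S1 Z1E] := clZ1; have [S2 Z2E] := clZ2.
apply: contrapT => /not_orP[/(bad _ _ Z1E)[y1 [p1 [Yy1 Sp1 yp1]]]].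
move=> /(bad _ _ Z2E)[y2 [p2 [Yy2 Sp2 yp2]]].
have [t] := nonroot (mulf_neq0 yp1 yp2); rewrite hornerM mulf_eq0 negb_or !linepE.
move=> /andP[/eqP t1 /eqP t2].
have [||] := Yirr' _ _ (slice S1 t) (slice S2 t).
- move=> y Yy; have [||] := sub12 (y + t *: delta_mx i 0); first by exists y, t.
    by rewrite Z1E => -[_ yS]; left; split; [exact: YX|exact: yS].
  by rewrite Z2E => -[_ yS]; right; split; [exact: YX|exact: yS].
- by move=> /(_ _ Yy1)[_ /(_ _ Sp1)].
- by move=> /(_ _ Yy2)[_ /(_ _ Sp2)].
Qed.

End ZariskiClosure.

(** * Codimension at least two from two vanishing coordinates *)

Section Codimension.
Context {K : numFieldType} {n : nat} (X : set 'cV[K]_n).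
Hypothesis X_free : forall z i t, X z -> z i 0 = 0 -> X (z + t *: delta_mx i 0).

(** The pair of vanishing coordinates may depend on the point; irreducibility, iterated along the
    finite list of pairs, makes it uniform on Y. *)
Lemma irreducible_coord_pair (Y : set 'cV[K]_n) (s : seq ('I_n * 'I_n)) : irreducible_closed X Y ->
  (forall y, Y y -> exists2 p, p \in s & y p.1 0 = 0 /\ y p.2 0 = 0) ->
  exists2 p, p \in s & forall y, Y y -> y p.1 0 = 0 /\ y p.2 0 = 0.
Proof.
move=> [Ycl [y0 Yy0] Yirr]; have YX : Y `<=` X by have [S ->] := Ycl => y [].
have closed_union (r : seq ('I_n * 'I_n)) : zariski_closed X
    (X `&` [set z | exists2 p, p \in r & z p.1 0 = 0 /\ z p.2 0 = 0]).
  elim: r => [|p r IH].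
    exists setT; apply/seteqP; split=> z [Xz]; first by case=> p; rewrite in_nil.
    by move=> /(_ 1 I)/eqP; rewrite mpoly.meval1 oner_eq0.
  have := closed_setU (closed_coord X [set i | i = p.1 \/ i = p.2]) IH.
  rewrite -setIUr; congr (zariski_closed _ (_ `&` _)).
  apply/seteqP; split=> z.
    case=> [zp|[q qr zq]]; last by exists q; rewrite // in_cons qr orbT.
    by exists p; [rewrite mem_head|split; apply: zp; [left|right]].
  case=> q; rewrite in_cons => /orP[/eqP ->|qr] zq; last by right; exists q.
  by left=> i [] ->; case: zq.
elim: s => [|p s IH] Ys; first by have [p] := Ys _ Yy0; rewrite in_nil.
have [|Yp|Ys'] := Yirr _ _ (closed_coord X [set i | i = p.1 \/ i = p.2]) (closed_union s).
- move=> y Yy; have [q + yq] := Ys y Yy; rewrite in_cons => /orP[/eqP qp|qs].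
    by left; split; [exact: YX|rewrite -qp => i [] ->; case: yq].
  by right; split; [exact: YX|exists q].
- exists p; first by rewrite mem_head.
  by move=> y /Yp[_ yp]; split; apply: yp; [left|right].
- have [|q qs Yq] := IH; first by move=> y /Ys'[].
  by exists q; rewrite // in_cons qs orbT.
Qed.

(* Freeing the two vanishing coordinates one after the other yields the chain. *)
Lemma codim_ge2 (Z : set 'cV[K]_n) :
  (forall z, Z z -> exists i j, [/\ i != j, z i 0 = 0 & z j 0 = 0]) ->
  codim_ge X 2 Z.
Proof.
move=> Z2 Y Yirr YZ; have [Ycl [y0 Yy0] _] := Yirr.
have YX : Y `<=` X by have [S ->] := Ycl => y [].
have [[i j] /= + Yij] : exists2 p, p \in [seq p <- enum {: 'I_n * 'I_n} | p.1 != p.2] &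
    forall y, Y y -> y p.1 0 = 0 /\ y p.2 0 = 0.
  apply: irreducible_coord_pair => // y /YZ/Z2[i [j [ij yi yj]]].
  by exists (i, j) => //; rewrite mem_filter ij mem_enum.
rewrite mem_filter => /andP[/= ij _].
have Yi y : Y y -> y i 0 = 0 by move=> /Yij[].
pose Y1 := zclosure X (cylinder Y i).
have Y1irr : irreducible_closed X Y1 by apply: irreducible_cylinder.
(* The equation z_j = 0 is closed and holds on the cylinder in direction i, so it survives in the
   closure and j can still be freed. *)
have Y1j y : Y1 y -> y j 0 = 0.
  have cl := closed_coord X [set l | l = j].
  have /(zclosure_min cl) sub :
      cylinder Y i `<=` X `&` [set z | forall l, [set l | l = j] l -> z l 0 = 0].
    move=> z zY; split; first exact: (cylinder_sub X_free Yirr Yi).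
    move=> l /= ->; case: zY => y' [t [/Yij[_ yj] ->]].
    by rewrite !mxE yj eq_sym (negPf ij) mulr0 addr0.
  by move=> /sub[_]; apply.
have Y1Y : Y `<=` Y1.
  by move=> y Yy; apply: (zclosure_sub (cylinder_sub X_free Yirr Yi)); apply: sub_cylinder.
have Y12 : Y1 `<=` zclosure X (cylinder Y1 j).
  by move=> y Yy; apply: (zclosure_sub (cylinder_sub X_free Y1irr Y1j)); apply: sub_cylinder.
have not_const (y : 'cV[K]_n) l : y l 0 = 0 -> (y + 1 *: delta_mx l 0) l 0 <> 0.
  by move=> yl; rewrite !mxE yl !eqxx mulr1 add0r => /eqP; rewrite oner_eq0.
exists (fun l => match l with 0 => Y | 1 => Y1 | _ => zclosure X (cylinder Y1 j) end).
split=> // [[|[|l]] //|[|[|]] // _].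
- by move=> _; apply: irreducible_cylinder.
- split=> // /(_ (y0 + 1 *: delta_mx i 0)) H; apply: (not_const y0 i); first exact: Yi.
  apply/Yi/H/(zclosure_sub (cylinder_sub X_free Yirr Yi)); by exists y0, 1.
- have Y1y0 := Y1Y _ Yy0.
  split=> // /(_ (y0 + 1 *: delta_mx j 0)) H; apply: (not_const y0 j); first exact: Y1j.
  apply/Y1j/H/(zclosure_sub (cylinder_sub X_free Y1irr Y1j)); by exists y0, 1.
Qed.

End Codimension.

(** * Exceptional loci of the quantum toric stacks *)

Section ExceptionalLocus.
Context {R : realType} {n d : nat} (h : 'M[R]_(d, n)) (k : 'M[R]_(n, n - d)).
Variable I : {set 'I_n}.
Implicit Types (D : set (set 'cV[R]_d)) (z : 'cV[R[i]]_n).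

Lemma cexp_neq0 (z : R[i]) : cexp z != 0.
Proof.
case: z => x y; rewrite /cexp eq_complex /= !mulf_eq0 (gt_eqF (expR_gt0 x)) /=.
apply/negP => /andP[/eqP cy /eqP sy]; have := cos2Dsin2 y.
by rewrite cy sy expr0n addr0 => /eqP; rewrite eq_sym oner_eq0.
Qed.

Lemma action_eq0 D t z i :
  action (quantum_toric_stack h k I D) t z i 0 = 0 <-> z i 0 = 0.
Proof.
rewrite mxE; split=> [/eqP|->]; last by rewrite mulr0.
by rewrite mulf_eq0 mxE (negPf (cexp_neq0 _)) => /eqP.
Qed.

(** Membership depends only on the set of zero coordinates, and having fewer zeros is harmless.
    Stability under the action and [S_free] both come from this. *)
Lemma S_zero D z z' : (forall i, z' i 0 = 0 -> z i 0 = 0) -> S_ h I D z -> S_ h I D z'.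
Proof.
move=> zz' [s [smax sz]]; exists s; split=> // i /sz; apply: contra => /eqP z'i.
by apply/eqP/zz'.
Qed.

Lemma S_free D z i t : S_ h I D z -> z i 0 = 0 -> S_ h I D (z + t *: delta_mx i 0).
Proof.
move=> Sz zi; apply: S_zero Sz => j; have [->//|ji] := eqVneq j i.
by rewrite !mxE (negPf ji) mulr0 addr0.
Qed.

Lemma maximal_cone_above D t : finite_set D -> D t ->
  exists2 s, maximal_cone D s & t `<=` s.
Proof.
move=> /finite_seqP[l ->]; rewrite /= => tl.
(* Greedy pass through the list: the current cone is replaced by each listed cone containing it. A
   cone containing the final one contained the current one when visited, so it was adopted then. *)
pose up m x : set 'cV[R]_d := if `[< m `<=` x >] then x else m.
have up_ge m x : m `<=` up m x by rewrite /up; case: ifPn => [/asboolP|_ y].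
have fold_ge r m : m `<=` foldl up m r.
  elim: r m => [m y //|x r IH m] /=; apply: subset_trans (IH _); exact: up_ge.
have fold_in r m : m \in l -> {subset r <= l} -> foldl up m r \in l.
  elim: r m => [//|x r IH] m ml rl; apply: IH => [|y yr].
    by rewrite /up; case: ifP => // _; apply: rl; rewrite mem_head.
  by apply: rl; rewrite in_cons yr orbT.
have fold_max r m x : x \in r -> foldl up m r `<=` x -> x `<=` foldl up m r.
  elim: r m => [m|y r IH m]; rewrite ?in_nil // in_cons => /orP[/eqP ->|xr] /= H; last exact: IH.
  suff -> : up m y = y by apply: fold_ge.
  rewrite /up; case: ifPn => // /asboolP[]; apply: subset_trans H.
  by apply: subset_trans (fold_ge _ _); apply: up_ge.
exists (foldl up t l); last exact: fold_ge.
split; first by apply: fold_in.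
by move=> x xl H; apply/seteqP; split=> //; apply: fold_max.
Qed.

(** A point of S(D1) without zeros lies in every chart of the common subfan. If z_i is its only
    zero, i indexes a ray, which belongs to both fans, and the chart of a maximal common cone above
    that ray contains the point. *)
Lemma exceptional_two_zeros D1 D2 z : fan D1 -> rays D1 = rays D2 ->
  rays D1 = [set ray_of h i | i in [set i | i \notin I]] -> D1 `&` D2 !=set0 ->
  S_ h I D1 z -> ~ S_ h I (D1 `&` D2) z ->
  exists i j, [/\ i != j, z i 0 = 0 & z j 0 = 0].
Proof.
move=> [finD _ _ Dcap] r12 r1 [t0 Dt0] [s [[Ds _] sz]] nS; apply: contrapT => no.
have fin12 : finite_set (D1 `&` D2) by apply: finite_setIl.
have [[i zi]|nz] := pselect (exists i, z i 0 = 0); last first.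
  have [s' s'max _] := maximal_cone_above fin12 Dt0.
  apply: nS; exists s'; split=> // i _; apply/eqP => zi; by apply: nz; exists i.
have [iI _] : cone_indices h I s i.
  by apply: contrapT => /sz; rewrite zi eqxx.
have ri : rays D1 (ray_of h i) by rewrite r1; exists i.
have Di : (D1 `&` D2) (ray_of h i).
  by split; [case: ri|move: ri; rewrite r12 => -[]].
have [s' s'max is'] := maximal_cone_above fin12 Di.
apply: nS; exists s'; split=> // j; have [->|ji] := eqVneq j i; last first.
  by move=> _; apply/eqP => zj; apply: no; exists j, i.
case; split=> //; split; last by case: ri.
have [[Ds' _] _] := s'max.
have [+ _] := Dcap _ _ Ds' (proj1 Di).
by rewrite (setIidr is').
Qed.

(** The polynomials [p s] are the monomials of the Cox irrelevant ideal: the product of the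
    coordinates outside sigma(1) is nonzero exactly on the chart of sigma. *)
Lemma S_complement_closed D1 D : zariski_closed (S_ h I D1) (S_ h I D1 `\` S_ h I D).
Proof.
pose p s : mpoly.mpoly n R[i] :=
  \prod_(i | `[< ~ cone_indices h I s i >]) mpoly.mpolyX _ (mpoly.mnm1 i).
have pE s z : mpoly.meval (fun i => z i 0) (p s) =
    \prod_(i | `[< ~ cone_indices h I s i >]) z i 0.
  by rewrite rmorph_prod; apply: eq_bigr => i _; rewrite /= mpoly.mevalXU.
have SE z : S_ h I D z <-> exists2 s, maximal_cone D s & mpoly.meval (fun i => z i 0) (p s) != 0.
  split=> [[s [smax sz]]|[s smax]].
    by exists s; rewrite // pE; apply/prodf_neq0 => i /asboolP/sz.
  by rewrite pE => /prodf_neq0 sz; exists s; split=> // i si; apply/sz/asboolP.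
exists [set p s | s in maximal_cone D]; apply/seteqP; split=> z [Sz nS]; split=> //.
  move=> _ [s smax <-]; apply/eqP/negPn/negP => ps; apply: nS; apply/SE; by exists s.
by move=> /SE[s smax /eqP]; apply; apply: nS; exists s.
Qed.

Lemma exceptional_codim D1 D2 : fan D1 -> rays D1 = rays D2 ->
  rays D1 = [set ray_of h i | i in [set i | i \notin I]] -> D1 `&` D2 !=set0 ->
  substack_codim_ge 2 (quantum_toric_stack h k I D1) (exceptional_locus h k I D1 D2).
Proof.
move=> fD1 r12 r1 D0; split; last first.
  apply: codim_ge2 => [z i t|z [Sz nS]]; first exact: S_free.
  exact: exceptional_two_zeros r12 r1 D0 Sz nS.
split=> [|//|t z [Sz nS]]; first exact: S_complement_closed.
split; first by apply: S_zero Sz => i /(action_eq0 D1 t z i).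
by move=> Saz; apply: nS; apply: S_zero Saz => i zi; apply/(action_eq0 D1 t z i).
Qed.

End ExceptionalLocus.

(** * Assembly of the theorem *)

Lemma normalize_polytope {R : realType} {n d : nat} (h : 'M[R]_(d, n)) D (I : {set 'I_n}) :
  geometric_map h -> polytopal_quantum_fan h D I ->
  exists b, [/\ full_polytope h b, tight h b, D = Delta_ h b & I = virtual h b].
Proof.
move=> hg [_ [b [fb -> ->]]]; exists (tighten h b).
split; [exact: full_tighten|exact: tight_tighten|by rewrite Delta_tighten|].
by rewrite virtual_tighten.
Qed.

(** The zero cone comes from an interior point of P_b, where nothing is tight. It keeps the subfan
    of common cones nonempty. *)
Lemma Delta_origin {R : realType} {n d : nat} (h : 'M[R]_(d, n)) b :
  geometric_map h -> full_polytope h b -> tight h b ->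
  Delta_ h b (cone_gen (fun i => col i h) finset.set0).
Proof.
move=> hg /(full_polytopeP _ hg)[_ [x xb]] tb.
suff <- : active h b x = finset.set0 by apply: Delta_active => // i; apply/ltW.
by apply/finset.setP => i; rewrite !inE; apply/negbTE; rewrite gt_eqF.
Qed.

Theorem theorem3p4p4 (R : realType) (n d : nat)
    (h : 'M[R]_(d, n)) (k : 'M[R]_(n, n - d))
    (Delta Delta0 : set (set 'cV[R]_d)) (I : {set 'I_n})
    (h_epi : epimorphism h) (h_geom : geometric_map h)
    (k_gale : gale_transform h k)
    (Delta_qf : polytopal_quantum_fan h Delta I)
    (Delta_chamber : chamber h k (Gamma h k Delta I))
    (Delta0_qf : polytopal_quantum_fan h Delta0 I)
    (Delta0_wall : wall_of h k (Gamma h k Delta I) (Gamma h k Delta0 I))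
    (Delta0_prod : exists F : set 'cV[R]_(n - d),
        facet (Gamma h k Delta finset.set0) F /\
        direct_sum (Gamma h k Delta0 I) F (gale_cone k I)) :
  exists Delta' : set (set 'cV[R]_d),
    [/\ polytopal_quantum_fan h Delta' I,
        chamber h k (Gamma h k Delta' I) &
        wall_between h k (Gamma h k Delta0 I)
          (Gamma h k Delta I) (Gamma h k Delta' I)] /\
    [/\ ~ simplicial_fan Delta0,
        rays Delta = rays Delta0 /\ rays Delta0 = rays Delta',
        finest_common_coarsening Delta0 Delta Delta',
        substack_codim_ge 2 (quantum_toric_stack h k I Delta)
          (exceptional_locus h k I Delta Delta0) &
        substack_codim_ge 2 (quantum_toric_stack h k I Delta')
          (exceptional_locus h k I Delta' Delta0)].
Proof.
have [qfD _] := Delta_qf; have [qfD0 _] := Delta0_qf.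
have [b [fb tb DE IE]] := normalize_polytope h_geom Delta_qf.
have [b0 [fb0 tb0 D0E I0E]] := normalize_polytope h_geom Delta0_qf.
have hpos := full_positively_spanning h_geom fb.
have sb : simple h b.
  by apply: (chamber_simple h_geom k_gale fb tb); rewrite -DE -IE.
have GE a : Gamma h k Delta I (k^T *m a) <-> Gcone h b a.
  rewrite DE IE; exact: Gamma_mem (full_nonempty h_geom fb).
have G0E a : Gamma h k Delta0 I (k^T *m a) <-> Gcone h b0 a.
  rewrite D0E I0E; exact: Gamma_mem (full_nonempty h_geom fb0).
have wallF : facet (Gamma h k Delta I) (Gamma h k Delta0 I) := Delta0_wall.2.
have := wallF; rewrite {1}DE {1}IE {1}D0E {1}I0E.
move=> /(facet_normal h_geom k_gale fb tb sb fb0 tb0)[u [z0 z_ge0 wallE z_line]].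
set z := k *m u in z0 z_ge0 wallE z_line.
have zE a : dot z a = dot u (k^T *m a) by rewrite dot_mulmxl.
have hz : h *m z = 0 by rewrite mulmxA (gale_mul0 k_gale) mul0mx.
have [b' xb'] := crosses_exists h_geom fb0 hz z0 wallE z_line.
have [fb' zb' _ _ _] := xb'.
have tb' := crosses_tight h_geom fb tb0 xb'.
have sb' := crosses_simple z_line xb'.
have I'E : I = virtual h b' by rewrite I0E (crosses_virtual h_geom fb tb0 xb').
have G'E a : Gamma h k (Delta_ h b') I (k^T *m a) <-> Gcone h b' a.
  rewrite I'E; exact: Gamma_mem (full_nonempty h_geom fb').
have qfD' : quantum_fan h (Delta_ h b') I.
  by rewrite I'E; apply: simple_quantum_fan.
have D'chamber : chamber h k (Gamma h k (Delta_ h b') I).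
  by rewrite I'E; apply: simple_chamber.
have G_ge0 v : Gamma h k Delta I v -> 0 <= dot u v.
  by have [a ->] := gale_surj k_gale v; rewrite -zE => /GE/z_ge0.
have G'_le0 v : Gamma h k (Delta_ h b') I v -> dot u v <= 0.
  have [a ->] := gale_surj k_gale v; rewrite -zE => /G'E.
  exact: (crosses_le0 h_geom fb0 hz z0 wallE z_line xb').
have G0_wall v : Gamma h k Delta0 I v <-> Gamma h k Delta I v /\ dot u v = 0.
  have [a ->] := gale_surj k_gale v; rewrite -zE.
  by split=> [/G0E/wallE[/GE]|[/GE Ga za]]; [|apply/G0E/wallE].
have G0_wall' v : Gamma h k Delta0 I v <-> Gamma h k (Delta_ h b') I v /\ dot u v = 0.
  have [a ->] := gale_surj k_gale v; rewrite -zE.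
  have wallE' := crosses_wallE h_geom fb0 hz z0 wallE z_line xb' a.
  by split=> [/G0E/wallE'[/G'E]|[/G'E Ga za]]; [|apply/G0E/wallE'].
have wall' : wall_of h k (Gamma h k (Delta_ h b') I) (Gamma h k Delta0 I).
  split=> //; split; last first.
    have [_ ->] := wallF; rewrite {1}DE {1}IE I'E.
    by rewrite (affdim_Gamma h_geom k_gale fb) // (affdim_Gamma h_geom k_gale fb').
  (* The wall is supported by the same hyperplane as before, seen from the other side, hence by the
     form - u. *)
  have [[G0n _] _] := wallF; split=> //; exists (- u), 0; split=> [v /G'_le0 uv|].
    by rewrite dotNl oppr_ge0.
  apply/seteqP; split=> v; first by move=> /G0_wall'[Gv uv]; rewrite /= dotNl uv oppr0.
  by move=> [Gv /eqP]; rewrite dotNl oppr_eq0 => /eqP uv; apply/G0_wall'.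
have rE D D' : quantum_fan h D I -> quantum_fan h D' I -> rays D = rays D'.
  by move=> [_ ->] [_ ->].
have codim2 D D' : quantum_fan h D I -> quantum_fan h D' I ->
    D `&` D' !=set0 ->
    substack_codim_ge 2 (quantum_toric_stack h k I D) (exceptional_locus h k I D D').
  by move=> qD qD'; apply: exceptional_codim; [case: qD|exact: rE|case: qD].
have O := Delta_origin h_geom fb tb; have O0 := Delta_origin h_geom fb0 tb0.
have O' := Delta_origin h_geom fb' tb'.
exists (Delta_ h b'); split; split=> //.
- by split=> //; exists b'.
- split=> // [GG'|].
    have : Gamma h k (Delta_ h b') I (k^T *m b') by apply/G'E; apply: Gcone_refl.
    by rewrite -GG' => /G_ge0; rewrite -zE leNgt zb'.
  apply/seteqP; split=> v; first by move=> Gv; split; [case/G0_wall: Gv|case/G0_wall': Gv].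
  by move=> [Gv G'v]; apply/G0_wall; split=> //; apply/eqP; rewrite eq_le G_ge0 // G'_le0.
- rewrite D0E; apply: (wall_not_simplicial h_geom tb0 hz z0 wallE z_line).
  by rewrite -D0E -I0E.
- by split; apply: rE.
- split; first by case: qfD0.
  + rewrite D0E DE; exact: (wall_coarsening h_geom fb tb fb0 tb0 wallE).
  + rewrite D0E; exact: (crosses_coarsening h_geom fb fb0 tb0 xb').
  + rewrite D0E DE => D fD.
    exact: (finest_coarsening h_geom fb tb sb fb0 tb0 hz z0 z_ge0 wallE z_line xb' fD).
- apply: codim2 => //; exists (cone_gen (fun i => col i h) finset.set0).
  by rewrite DE D0E.
- apply: codim2 => //; exists (cone_gen (fun i => col i h) finset.set0).
  by rewrite D0E.
Qed.
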